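(* Let $D$ be a double section over $\mathbb{C}$. There exists a family $\{W^u\}_{u\in\mathbb{C}(z)}$ (indexed by the entire functions $u$ of one variable) of holomorphic vector fields on $(\mathbb{C}\times\mathbb{P}^1)\setminus D$ which are complete, of type $\mathbb{C}^*$, and whose trajectories are contained in vertical lines (fibers $\{z=\text{const}\}$). Moreover, each $W^u$ vanishes only along $D$.
   Context: $\mathbb{C}(z)$ denotes the ring of entire functions of one complex variable. A double section over $\mathbb{C}$ is a complex subvariety $D\subset\mathbb{C}\times\mathbb{P}^1$ of dimension one of the form $D=\{(z,w): a(z)w^2+b(z)w+c(z)=0\}$, where $a,b,c$ are holomorphic functions on $\mathbb{C}$. In the last assertion, $W^u$ is regarded as a holomorphic vector field on all of $\mathbb{C}\times\mathbb{P}^1$. A holomorphic vector field $X$ on a complex surface $M$ is complete if its solution through every point is defined for all complex times $t\in\mathbb{C}$. The trajectory $C_p$ of $X$ through $p$ is the image of the maximal solution through $p$. A trajectory is of type $\mathbb{C}$ (resp. $\mathbb{C}^*$) if it is analytically isomorphic to $\mathbb{C}$ (resp. $\mathbb{C}^*$). A complete $X$ is of type $\mathbb{C}$ (resp. $\mathbb{C}^*$) if all trajectories $C_p$ with $p$ outside some pluripolar subset of $M$ invariant by the flow are of type $\mathbb{C}$ (resp. $\mathbb{C}^*$).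
   Formalization: The double section is required to have discriminant b²−4ac not identically zero, so that it meets the generic fiber in two points; otherwise the claim fails, e.g. for D={w=∞} (a=b=0, c=1), where such fields are of type ℂ. *)

(* Defs.v *)
From HB Require Import structures.
From mathcomp Require Export all_boot all_order all_algebra.
From mathcomp Require Export all_classical all_reals all_analysis.
From mathcomp Require Export complex.
Set Implicit Arguments.
Unset Strict Implicit.
Unset Printing Implicit Defensive.
Export Order.TTheory GRing.Theory Num.Theory numFieldNormedType.Exports.
Local Open Scope classical_set_scope.
Local Open Scope ring_scope.

(* R[i] as a normed space over itself, so that derivatives of functions on
   R[i] and on R[i] * R[i] are complex derivatives. *)
HB.instance Definition _ (R : realType) := NormedModule.copy R[i] (R[i]^o).

Definition entire (R : realType) (f : R[i] -> R[i]) : Prop :=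
  forall z, derivable f z 1.

(* The complex projective line: [Fin w] is [w : 1] and [Inf] is [1 : 0]. *)
Inductive P1 (R : realType) : Type := Fin of R[i] | Inf.
Arguments Inf {R}.

Definition CP1 (R : realType) : Type := (R[i] * P1 R)%type.

(* The two standard charts of C x P^1, as parametrizations by C^2; the second
   one is (z, v) |-> (z, [1 : v]), that is w = 1/v. *)
Definition chart (R : realType) (i : bool) (x : R[i] * R[i]) : CP1 R :=
  if i then (x.1, if x.2 == 0 then Inf else Fin x.2^-1) else (x.1, Fin x.2).

(* The equation a(z) w^2 + b(z) w + c(z) = 0 on C x P^1 is understood after
   homogenization, so it reads a(z) = 0 at w = infinity. *)
Definition quadric (R : realType) (a b c : R[i] -> R[i]) : set (CP1 R) :=
  [set p | match p.2 with
           | Fin w => a p.1 * w ^+ 2 + b p.1 * w + c p.1 = 0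
           | Inf => a p.1 = 0
           end].

(* The discriminant does not vanish identically: the general fiber meets D in
   exactly two points.  This excludes the sections counted twice, and also
   a = b = c = 0, the only case where the dimension is not one.  Common zeros
   of a, b, c, for which D contains a whole fiber, are allowed. *)
Definition double_section (R : realType) (D : set (CP1 R)) : Prop :=
  exists a b c : R[i] -> R[i],
    [/\ entire a, entire b, entire c,
        exists z, b z ^+ 2 - 4%:R * a z * c z != 0
      & D = quadric a b c].

(* Throughout, M is an open subset of C x P^1, regarded as a complex surface. *)

(* A vector field is given by its two components in each chart; the values at
   x with [chart i x] outside of M are irrelevant. *)
Definition vfield (R : realType) : Type := bool -> R[i] * R[i] -> R[i] * R[i].

(* The components agree on the overlap, where v = 1/w and dv = - dw / w^2. *)
Definition holomorphic_vfield (R : realType) (M : set (CP1 R)) (X : vfield R) :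
    Prop :=
  (forall z w, w != 0 -> M (z, Fin w) ->
     X true (z, w^-1) = ((X false (z, w)).1, - (X false (z, w)).2 / w ^+ 2)) /\
  (forall i x, M (chart i x) -> differentiable (X i) x).

Definition vanishes (R : realType) (X : vfield R) (p : CP1 R) : Prop :=
  exists i x, chart i x = p /\ X i x = 0.

Definition holomorphic_curve (R : realType) (U : set R[i])
    (h : R[i] -> CP1 R) : Prop :=
  forall t, U t -> exists (i : bool) (x : R[i] -> R[i] * R[i]),
    (\forall s \near t, h s = chart i (x s)) /\ derivable x t 1.

(* phi : U -> M is a solution of phi'(t) = X(phi(t)), with complex time t. *)
Definition solution (R : realType) (M : set (CP1 R)) (X : vfield R)
    (U : set R[i]) (phi : R[i] -> CP1 R) : Prop :=
  forall t, U t -> M (phi t) /\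
    exists (i : bool) (x : R[i] -> R[i] * R[i]),
      (\forall s \near t, phi s = chart i (x s)) /\ is_derive t 1 x (X i (x t)).

Definition solution_through (R : realType) (M : set (CP1 R)) (X : vfield R)
    (p : CP1 R) (U : set R[i]) (phi : R[i] -> CP1 R) : Prop :=
  [/\ open U, connected U, U 0, solution M X U phi & phi 0 = p].

Definition maximal_solution (R : realType) (M : set (CP1 R)) (X : vfield R)
    (p : CP1 R) (U : set R[i]) (phi : R[i] -> CP1 R) : Prop :=
  solution_through M X p U phi /\
  forall V psi, solution_through M X p V psi ->
    V `<=` U /\ forall t, V t -> psi t = phi t.

Definition complete (R : realType) (M : set (CP1 R)) (X : vfield R) : Prop :=
  forall p, M p -> exists phi, maximal_solution M X p setT phi.

Definition trajectory (R : realType) (M : set (CP1 R)) (X : vfield R)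
    (p : CP1 R) : set (CP1 R) :=
  [set q | exists U phi, maximal_solution M X p U phi /\
                         exists2 t, U t & phi t = q].

(* An analytic isomorphism h : A -> C_p with inverse g, for A open in C.  The
   trajectory C_p carries the complex structure given by the time parameter,
   so g is holomorphic on C_p when it is so along the maximal solution. *)
Definition trajectory_isomorphic (R : realType) (M : set (CP1 R))
    (X : vfield R) (p : CP1 R) (A : set R[i]) : Prop :=
  exists (h : R[i] -> CP1 R) (g : CP1 R -> R[i]),
    [/\ holomorphic_curve A h,
        forall U phi, maximal_solution M X p U phi ->
          forall t, U t -> derivable (g \o phi) t 1,
        forall s, A s -> trajectory M X p (h s) /\ g (h s) = s
      & forall q, trajectory M X p q -> A (g q) /\ h (g q) = q].

(* u is upper semicontinuous on the open set B of C^2, with values in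
   [-oo, +oo[, and satisfies the sub-mean value inequality on every closed
   disc {x + l y : |l| <= 1} contained in B. *)
Definition plurisubharmonic (R : realType) (B : set (R[i] * R[i]))
    (u : R[i] * R[i] -> \bar R) : Prop :=
  [/\ forall x, B x -> (u x < +oo)%E,
      forall x (k : R), B x -> (u x < k%:E)%E ->
        \forall y \near x, (u y < k%:E)%E
    & forall x y : R[i] * R[i], (forall l : R[i], `|l| <= 1 -> B (x + l *: y)) ->
        (u x <= ((2 * pi)^-1)%:E *
          \int[lebesgue_measure]_(theta in `[0%R, (2 * pi)%R])
            u (x + (cos theta +i* sin theta)%C *: y)%R)%E].

(* E is pluripolar in M: near each of its points, E is contained in the set
   {u = -oo} for some plurisubharmonic u which is not identically -oo; the
   neighborhood is a coordinate ball, hence connected. *)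
Definition pluripolar (R : realType) (M E : set (CP1 R)) : Prop :=
  E `<=` M /\
  forall p, E p -> exists i x (r : R[i]) (u : R[i] * R[i] -> \bar R),
    [/\ chart i x = p, 0 < r, ball x r `<=` chart i @^-1` M,
        plurisubharmonic (ball x r) u
      & (exists2 y, ball x r y & u y <> -oo%E) /\
        (forall y, ball x r y -> E (chart i y) -> u y = -oo%E)].

Definition flow_invariant (R : realType) (M : set (CP1 R)) (X : vfield R)
    (E : set (CP1 R)) : Prop :=
  forall p, E p -> trajectory M X p `<=` E.

Definition of_type (R : realType) (A : set R[i]) (M : set (CP1 R))
    (X : vfield R) : Prop :=
  exists E, [/\ pluripolar M E, flow_invariant M X E
    & forall p, M p -> ~ E p -> trajectory_isomorphic M X p A].

Definition Cstar (R : realType) : set R[i] := [set t | t != 0].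

Definition vertical_trajectories (R : realType) (M : set (CP1 R))
    (X : vfield R) : Prop :=
  forall p, M p -> exists z, trajectory M X p `<=` [set q | q.1 = z].

(* Main.v *)
(** The field is the Riccati field W^u = e^u (a w^2 + b w + c) d/dw, which has no
    component along z, so everything happens in one fibre at a time.  There it is
    the projectivization of a linear field v' = N v with N^2 = k, where k is a
    quarter of the discriminant; its flow is the complete Moebius flow of
    exp(t N) = ch(t) + sh(t) N, and the quadratic form det(N v, v), which defines D,
    is invariant.  For k <> 0 the orbit of v is [s P + Q] with s = e^(2 d t),
    d^2 = k, and P, Q eigenvectors of N, so it is a C^*.  The remaining fibres are
    those where the discriminant vanishes.  Its zeros are isolated, so near each of
    them these fibres are the polar set of log|z - z0|.

    Isolatedness of the zeros of an entire function, which here is only assumed to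
    have a derivative everywhere, comes from Goursat's theorem in logarithmic
    coordinates, which gives the mean value property on circles; applied to
    difference quotients it shows that f' is entire and then that
    (f - f(w)) / (z - w) is entire, so if zeros cluster at 0 every power z^n can be
    divided out of f, and the maximum principle for the quotients forces f = 0. *)

Require Import Defs.
From mathcomp Require Import ring lra measurable_realfun.
Set Implicit Arguments.
Unset Strict Implicit.
Unset Printing Implicit Defensive.
Local Open Scope classical_set_scope.
Local Open Scope ring_scope.
Import ComplexField.Normc.
Local Notation Re := complex.Re.
Local Notation Im := complex.Im.

(** * Limits and derivatives in the complex plane *)

(** The factor e^u is absorbed into the coefficients: e^u a, e^u b, e^u c are again entire, define
    the same D and have discriminant e^(2u) times the old one, so a single Riccati field has to be
    studied. With w = x/y and N = [[b/2, c], [-a, -b/2]], the linear lift crosses w = infinity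
    without any change of chart, and the invariance of det(N v, v) does two jobs at once: the lift
    never becomes 0, and the orbit never meets D. Maximality demands a comparison with every
    solution on a connected domain; a first integral does this globally, in place of a local
    uniqueness theorem followed by a continuation argument. Over a zero of the discriminant N is
    nilpotent, and the orbits off D are [v + t N v], hence copies of C; this is why such fibres must
    go into the pluripolar set. Subharmonicity of log|z - z0| is required on all discs, including
    those whose boundary circle passes through the pole, so it is obtained by regularizing the
    logarithm and applying Fatou's lemma. *)

Section ComplexPlane.
Variable R : realType.
Implicit Types (z w h : R[i]) (e d : R).

Lemma normrC z : `|z| = (normc z)%:C%C.
Proof. by []. Qed.

Lemma normc_ge0 z : 0 <= normc z.
Proof. by case: z => a b; rewrite /normc sqrtr_ge0. Qed.

(** The norm of [R[i]] takes its values in [R[i]], where a positive element is real. This turns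
    complex radii and tolerances into real ones. *)
Lemma gtC0P (e : R[i]) : 0 < e -> exists2 d : R, 0 < d & e = d%:C%C.
Proof.
case: e => a b; rewrite ltcE /= => /andP[/eqP -> a0].
by exists a.
Qed.

Lemma nearCP z (P : R[i] -> Prop) :
  (\forall y \near z, P y) <->
  exists2 e : R, 0 < e & forall y, normc (y - z) < e -> P y.
Proof.
split.
  case/nbhs_ballP => e /gtC0P[d d0 ->] H; exists d => // y yz.
  apply: H; rewrite /ball /= distrC normrC ltcR //.
case=> e e0 H; apply/nbhs_ballP; exists e%:C%C => /=; first by rewrite ltcR.
by move=> y; rewrite /ball /= distrC normrC ltcR => /H.
Qed.

Lemma nearRP (x : R) (P : R -> Prop) :
  (\forall y \near x, P y) <->
  exists2 e : R, 0 < e & forall y, `|y - x| < e -> P y.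
Proof.
split.
  case/nbhs_ballP => e /= e0 H; exists e => // y yz.
  by apply: H; rewrite /ball /= distrC.
case=> e e0 H; apply/nbhs_ballP; exists e => //=.
by move=> y; rewrite /ball /= distrC => /H.
Qed.

Lemma cvgCP (T : Type) (F : set_system T) (FF : Filter F) (f : T -> R[i]) w :
  f @ F --> w <-> forall e : R, 0 < e -> \forall x \near F, normc (f x - w) < e.
Proof.
split.
  move=> /cvgrPdist_lt H e e0.
  have := H e%:C%C; rewrite ltcR => /(_ e0).
  by apply: filterS => x; rewrite distrC normrC ltcR.
move=> H; apply/cvgrPdist_lt => e /gtC0P[d d0 ->].
by apply: filterS (H _ d0) => x; rewrite distrC normrC ltcR.
Qed.

(** First-order expansion without division and with [h = 0] allowed, a form in which error estimates
    can be added. *)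
Lemma is_deriveCP (f : R[i] -> R[i]) z l :
  is_derive z 1 f l <->
  forall e : R, 0 < e -> exists2 d : R, 0 < d & forall h, normc h < d ->
    normc (f (z + h) - f z - l * h) <= e * normc h.
Proof.
split.
  case=> fz /= <- e e0.
  have /cvgCP/(_ e e0)/nearCP : h^-1 *: ((f \o shift z) (h *: 1) - f z) @[h --> 0^'] --> 'D_1 f z by [].
  case=> d d0 H; exists d => // h hd.
  have [->|h0] := eqVneq h 0.
    by rewrite addr0 subrr mulr0 subr0 normc0 mulr0.
  have := H h; rewrite subr0 => /(_ hd h0) /=.
  rewrite [h *: 1]mulr1 [_ *: _]/(_ * _) (addrC h) => {}H.
  have -> : f (z + h) - f z - 'D_1 f z * h = (h^-1 * (f (z + h) - f z) - 'D_1 f z) * h.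
    by field.
  by rewrite normcM ler_wpM2r ?normc_ge0 // ltW.
move=> H.
have C : h^-1 *: ((f \o shift z) (h *: 1) - f z) @[h --> 0^'] --> l.
  apply/cvgCP => e e0; have [d d0 {}H] := H (e / 2) (divr_gt0 e0 (ltr0n _ 2)).
  apply/nearCP; exists d => // h; rewrite subr0 => hd h0 /=.
  rewrite [h *: 1]mulr1 [_ *: _]/(_ * _) (addrC h).
  have -> : h^-1 * (f (z + h) - f z) - l = (f (z + h) - f z - l * h) / h by field.
  have hp : 0 < normc h.
    by rewrite lt_def normc_ge0 andbT; apply: contra_neq h0 => /eq0_normc.
  rewrite normcM normcV ltr_pdivrMr //.
  by apply: le_lt_trans (H _ hd) _; rewrite ltr_pM2r // ltr_pdivrMr // ltr_pMr // ltr1n.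
by apply: DeriveDef; [apply/cvg_ex; exists l|apply/cvg_lim].
Qed.

Lemma is_deriveRP (f : R -> R) (z l : R) :
  is_derive z 1 f l <->
  forall e : R, 0 < e -> exists2 d : R, 0 < d & forall h : R, `|h| < d ->
    `|f (z + h) - f z - l * h| <= e * `|h|.
Proof.
split.
  case=> fz /= <- e e0.
  have /cvgrPdist_lt/(_ e e0)/nearRP : h^-1 *: ((f \o shift z) (h *: 1) - f z) @[h --> 0^'] --> 'D_1 f z by [].
  case=> d d0 H; exists d => // h hd.
  have [->|h0] := eqVneq h 0.
    by rewrite addr0 subrr mulr0 subr0 normr0 mulr0.
  have := H h; rewrite subr0 => /(_ hd h0) /=.
  rewrite [h *: 1]mulr1 [_ *: _]/(_ * _) (addrC h) distrC => {}H.
  have -> : f (z + h) - f z - 'D_1 f z * h = (h^-1 * (f (z + h) - f z) - 'D_1 f z) * h.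
    by field.
  by rewrite normrM ler_wpM2r // ltW.
move=> H.
have C : h^-1 *: ((f \o shift z) (h *: 1) - f z) @[h --> 0^'] --> l.
  apply/cvgrPdist_lt => e e0; have [d d0 {}H] := H (e / 2) (divr_gt0 e0 (ltr0n _ 2)).
  apply/nearRP; exists d => // h; rewrite subr0 => hd h0 /=.
  rewrite [h *: 1]mulr1 [_ *: _]/(_ * _) (addrC h) distrC.
  have -> : h^-1 * (f (z + h) - f z) - l = (f (z + h) - f z - l * h) / h by field.
  have hp : 0 < `|h| by rewrite normr_gt0.
  rewrite normrM normfV ltr_pdivrMr //.
  by apply: le_lt_trans (H _ hd) _; rewrite ltr_pM2r // ltr_pdivrMr // ltr_pMr // ltr1n.
by apply: DeriveDef; [apply/cvg_ex; exists l|apply/cvg_lim].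
Qed.

Lemma Re_le_normc z : `|Re z| <= normc z.
Proof.
case: z => a b /=; rewrite -sqrtr_sqr ler_wsqrtr // lerDl sqr_ge0 //.
Qed.

Lemma Im_le_normc z : `|Im z| <= normc z.
Proof.
case: z => a b /=; rewrite -sqrtr_sqr ler_wsqrtr // lerDr sqr_ge0 //.
Qed.

Lemma normc_le_ReIm z : normc z <= `|Re z| + `|Im z|.
Proof.
case: z => a b /=; rewrite -[leRHS]ger0_norm ?addr_ge0 // -sqrtr_sqr ler_wsqrtr //.
rewrite sqrrD !real_normK ?num_real // -addrA lerD2l lerDr mulrn_wge0 // mulr_ge0 //.
Qed.

Lemma normc_Creal (x : R) : normc x%:C%C = `|x|.
Proof. by rewrite /= expr0n /= addr0 sqrtr_sqr. Qed.

Lemma normcJ z : normc (conjc z) = normc z.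
Proof. by case: z => a b /=; rewrite sqrrN. Qed.

Lemma normc_sqr z : normc z ^+ 2 = Re z ^+ 2 + Im z ^+ 2.
Proof. by case: z => a b /=; rewrite sqr_sqrtr // addr_ge0 // sqr_ge0. Qed.

Lemma normc_eq0 z : (normc z == 0) = (z == 0).
Proof. by apply/eqP/eqP => [/eq0_normc //|->]; rewrite normc0. Qed.

Lemma normc_gt0 z : (0 < normc z) = (z != 0).
Proof. by rewrite lt_def normc_ge0 andbT normc_eq0. Qed.

Lemma normcB z w : normc (z - w) = normc (w - z).
Proof. by rewrite -normcN opprB. Qed.

Lemma continuousCP (f : R[i] -> R[i]) z :
  {for z, continuous f} <-> forall e : R, 0 < e ->
    exists2 d : R, 0 < d & forall y, normc (y - z) < d -> normc (f y - f z) < e.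
Proof.
have FF : Filter (nbhs z) by exact: nbhs_filter.
split=> H; first by move=> e e0; apply/nearCP; apply: (iffLR (cvgCP FF f (f z)) H).
by apply/(cvgCP FF f (f z)) => e e0; apply/nearCP; exact: H.
Qed.

End ComplexPlane.

(** * Real differentiability in the plane and the complex exponential *)

Section RealDiff.
Variable R : realType.

(** Total differentiability of a curried function, with partial derivatives [a] and [b]; increments
    are measured in the l^1 norm. *)
Definition rdiff (F : R -> R -> R) (x y a b : R) : Prop :=
  forall e : R, 0 < e -> exists2 d : R, 0 < d &
    forall h k : R, `|h| < d -> `|k| < d ->
      `|F (x + h) (y + k) - F x y - (a * h + b * k)| <= e * (`|h| + `|k|).

Lemma is_diff_rdiff (F : R * R -> R) (df : R * R -> R) (x y : R) :
  is_diff (x, y) F df ->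
  rdiff (fun x y => F (x, y)) x y (df (1, 0)) (df (0, 1)).
Proof.
move=> [dF dfE] e e0.
have /eqaddoP/(_ e e0) := diff_locally dF.
case/nbhs_ballP => d /= d0 H; exists d => // h k hd kd.
have := H (h, k); rewrite /ball /= /prod_ball /= /ball /= !sub0r !normrN.
move=> /(_ (conj hd kd)); rewrite !fctE /=.
have -> : (h, k) + (x, y) = (x + h, y + k).
  by rewrite (addrC x) (addrC y).
have -> : 'd F (x, y) (h, k) = df (1, 0) * h + df (0, 1) * k.
  rewrite -dfE (_ : (h, k) = h *: (1, 0) + k *: (0, 1)).
    by rewrite linearD !linearZ; congr (_ + _); exact: mulrC.
  have -> : h *: (1, 0) + k *: (0, 1) = (h * 1 + k * 0, h * 0 + k * 1) :> R * R by [].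
  by rewrite !mulr1 !mulr0 addr0 add0r.
rewrite opprD addrA => {H} H; apply: le_trans H _.
apply: ler_wpM2l; first exact: ltW.
have -> : `|(h, k)| = Num.max `|h| `|k| by [].
by rewrite ge_max lerDl lerDr !normr_ge0.
Qed.

Lemma is_derive_is_diff (f : R -> R) (x l : R) :
  is_derive x 1 f l -> is_diff x f (fun h => h * l).
Proof.
move=> [fx <-]; have dfx : differentiable f x by apply/derivable1_diffP.
apply: DiffDef => //; rewrite diff1E // derive1E.
by [].
Qed.

Lemma is_diff_fst (p : R * R) : is_diff p (@fst R R) fst.
Proof.
apply: DiffDef; first by apply: linear_differentiable => x; exact: cvg_fst.
by rewrite diff_lin //; move=> x; exact: cvg_fst.
Qed.

Lemma is_diff_snd (p : R * R) : is_diff p (@snd R R) snd.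
Proof.
apply: DiffDef; first by apply: linear_differentiable => x; exact: cvg_snd.
by rewrite diff_lin //; move=> x; exact: cvg_snd.
Qed.

(** The Cauchy-Riemann equations are encoded by the coefficients shared by the two hypotheses: they
    make the real differential a multiplication by a + ib. *)
Lemma CR_is_derive (u v : R -> R -> R) (x y a b : R) :
  rdiff u x y a (- b) -> rdiff v x y b a ->
  is_derive (x +i* y)%C 1 (fun z : R[i] => (u (Re z) (Im z) +i* v (Re z) (Im z))%C)
    (a +i* b)%C.
Proof.
move=> Hu Hv; apply/is_deriveCP => e e0.
have e4 : 0 < e / 4 by lra.
have [d1 d10 {}Hu] := Hu _ e4; have [d2 d20 {}Hv] := Hv _ e4.
exists (Num.min d1 d2); first by rewrite lt_min d10.
case=> h k; rewrite lt_min => /andP[hd1 hd2].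
have := Re_le_normc (h +i* k)%C; have := Im_le_normc (h +i* k)%C.
set n := normc _ in hd1 hd2 *; rewrite [Re _]/= [Im _]/= => kn hn.
apply: le_trans (normc_le_ReIm _) _ => /=.
have {}Hu := Hu h k (le_lt_trans hn hd1) (le_lt_trans kn hd1).
have {}Hv := Hv h k (le_lt_trans hn hd2) (le_lt_trans kn hd2).
have -> : u (x + h) (y + k) - u x y - (a * h - b * k) =
  u (x + h) (y + k) - u x y - (a * h + - b * k) by ring.
have -> : v (x + h) (y + k) - v x y - (a * k + b * h) =
  v (x + h) (y + k) - v x y - (b * h + a * k) by ring.
have : e / 4 * (`|h| + `|k|) <= e / 4 * (n + n) by rewrite ler_pM2l // lerD.
lra.
Qed.

Lemma rdiff_sep (f g : R -> R) (x y l m : R) :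
  is_derive x 1 f l -> is_derive y 1 g m ->
  rdiff (fun x y => f x * g y) x y (l * g y) (f x * m).
Proof.
move=> /is_derive_is_diff fx /is_derive_is_diff gy.
have D1 := @is_diff_comp _ _ _ _ fst fst f _ (x, y) (is_diff_fst (x, y)) fx.
have D2 := @is_diff_comp _ _ _ _ snd snd g _ (x, y) (is_diff_snd (x, y)) gy.
have := is_diff_rdiff (is_diffM D1 D2); rewrite !fctE /=.
by rewrite !mul0r !mul1r !scaler0 add0r addr0 [g y *: l]mulrC.
Qed.

Definition cexp (z : R[i]) : R[i] :=
  Complex (expR (Re z) * cos (Im z)) (expR (Re z) * sin (Im z)).

Lemma is_derive_cexp (z : R[i]) : is_derive z 1 cexp (cexp z).
Proof.
case: z => x y.
apply: (@CR_is_derive (fun x y => expR x * cos y) (fun x y => expR x * sin y)).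
  by rewrite -mulrN; apply: rdiff_sep.
by apply: rdiff_sep.
Qed.

Lemma cexp0 : cexp 0 = 1.
Proof. by rewrite /cexp /= expR0 cos0 sin0 mulr1 mulr0. Qed.

Lemma cexpD z w : cexp (z + w) = cexp z * cexp w.
Proof.
case: z w => a b [c d]; rewrite /cexp /= expRD cosD sinD.
by congr Complex; ring.
Qed.

Lemma cexp_neq0 z : cexp z != 0.
Proof.
apply/eqP => z0; have := cexpD z (- z).
by rewrite subrr z0 mul0r cexp0 => /eqP; rewrite oner_eq0.
Qed.

Lemma cexpN z : cexp (- z) = (cexp z)^-1.
Proof.
have := cexpD z (- z); rewrite subrr cexp0 => H.
by apply: (mulfI (cexp_neq0 z)); rewrite -H divff // cexp_neq0.
Qed.

Lemma normc_cexp z : normc (cexp z) = expR (Re z).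
Proof.
case: z => a b /=; rewrite !exprMn -mulrDr cos2Dsin2 mulr1 sqrtr_sqr ger0_norm //.
Qed.

Lemma unit_circleP (x y : R) : x ^+ 2 + y ^+ 2 = 1 ->
  exists t, x = cos t /\ y = sin t.
Proof.
move=> xy; have x1 : -1 <= x <= 1.
  by apply/andP; split; nra.
have sx : Num.sqrt (1 - x ^+ 2) = `|y|.
  by rewrite -xy addrAC subrr add0r sqrtr_sqr.
(* [acos] only reaches the upper half circle, so the sign of [y] decides the sign of the angle. *)
have [y0|y0] := leP 0 y.
  exists (acos x); rewrite acosK // sin_acos // sx ger0_norm //.
exists (- acos x); rewrite cosN sinN acosK // sin_acos // sx ltr0_norm //.
by rewrite opprK.
Qed.

(** Polar coordinates. Surjectivity onto C^* is what makes a nondegenerate orbit a full C^* later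
    on. *)
Lemma cexp_surj w : w != 0 -> exists z, cexp z = w.
Proof.
move=> w0; have n0 : 0 < normc w by rewrite normc_gt0.
case: (@unit_circleP (Re w / normc w) (Im w / normc w)).
  by rewrite !expr_div_n -mulrDl -normc_sqr divff // sqrf_eq0 gt_eqF.
move=> t [ct st]; exists (ln (normc w) +i* t)%C.
rewrite /cexp /= lnK ?posrE // -ct -st; case: w n0 {w0 ct st} => a b n0.
by congr Complex => /=; rewrite mulrCA divff ?mulr1 // gt_eqF.
Qed.

End RealDiff.

(** * Complex derivatives and the mean value inequality *)

Section ComplexDerivatives.
Variable R : realType.
Implicit Types (f g : R[i] -> R[i]) (z w l : R[i]).

Lemma is_derive_is_diffC f z l : is_derive z 1 f l -> is_diff z f (fun h => h * l).
Proof.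
move=> [fx <-]; have dfx : differentiable f z by apply/derivable1_diffP.
apply: DiffDef; first exact: dfx.
rewrite (diff1E dfx) derive1E.
reflexivity.
Qed.

Lemma is_derive_compC f g z l m :
  is_derive z 1 g m -> is_derive (g z) 1 f l -> is_derive z 1 (f \o g) (l * m).
Proof.
move=> gz fz; have G := is_derive_is_diffC gz; have F := is_derive_is_diffC fz.
have [D E] := is_diff_comp G F.
apply: DeriveDef; first by apply/derivable1_diffP.
rewrite deriveE // E /=; ring.
Qed.

Lemma rdiff_ReIm f (x y : R) l : is_derive (x +i* y)%C 1 f l ->
  rdiff (fun x y => Re (f (x +i* y)%C)) x y (Re l) (- Im l) /\
  rdiff (fun x y => Im (f (x +i* y)%C)) x y (Im l) (Re l).
Proof.
move=> /is_deriveCP H.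
have {}H e : 0 < e -> exists2 d : R, 0 < d & forall h k : R, `|h| < d -> `|k| < d ->
    normc (f ((x + h) +i* (y + k))%C - f (x +i* y)%C - l * (h +i* k)%C)
      <= e * (`|h| + `|k|).
  move=> e0; have [d d0 Hd] := H e e0; exists (d / 2) => [|h k hd kd]; first lra.
  have le : normc (h +i* k)%C <= `|h| + `|k| by exact: normc_le_ReIm.
  apply: le_trans (Hd (h +i* k)%C _) _; last by rewrite ler_pM2l.
  by apply: le_lt_trans le _; lra.
split=> e /H[d d0 {}H]; exists d => // h k hd kd; apply: le_trans (H h k hd kd).
- apply: le_trans (Re_le_normc _); rewrite le_eqVlt; apply/orP; left; apply/eqP.
  case: (f _) => a b; case: (f _) => a' b'; case: (l) => c c' /=; congr (`|_|); ring.
- apply: le_trans (Im_le_normc _); rewrite le_eqVlt; apply/orP; left; apply/eqP.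
  case: (f _) => a b; case: (f _) => a' b'; case: (l) => c c' /=; congr (`|_|); ring.
Qed.

Lemma is_derive_Re_line f (c z h : R[i]) (t : R) l :
  is_derive (z + t%:C%C * h) 1 f l ->
  is_derive t 1 (fun t : R => Re (c * f (z + t%:C%C * h))) (Re (c * l * h)).
Proof.
move=> /is_deriveCP H; apply/is_deriveRP => e e0.
pose K := normc c * normc h + 1.
have K0 : 0 < K by rewrite ltr_wpDl // mulr_ge0 // normc_ge0.
have h0 := normc_ge0 h; have c0 := normc_ge0 c.
have [d d0 {}H] := H (e / K) (divr_gt0 e0 K0).
exists (d / (normc h + 1)) => [|s sd]; first by rewrite divr_gt0 // ltr_wpDl.
have -> : Re (c * f (z + (t + s)%:C%C * h)) - Re (c * f (z + t%:C%C * h)) - Re (c * l * h) * s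
  = Re (c * (f (z + t%:C%C * h + s%:C%C * h) - f (z + t%:C%C * h) - l * (s%:C%C * h))).
  have -> : z + (t + s)%:C%C * h = z + t%:C%C * h + s%:C%C * h.
    by rewrite rmorphD /= mulrDl addrA.
  case: (f _) => a b; case: (f _) => a' b'; case: (c) => p q; case: (l) => r v; case: (h) => u w /=; ring.
apply: le_trans (Re_le_normc _) _; rewrite normcM.
have sh : normc (s%:C%C * h) = `|s| * normc h by rewrite normcM normc_Creal.
have := H (s%:C%C * h); rewrite sh => {}H.
have {}H : normc (f (z + t%:C%C * h + s%:C%C * h) - f (z + t%:C%C * h) - l * (s%:C%C * h)) <= e / K * (`|s| * normc h).
  apply: H; move: sd; rewrite ltr_pdivlMr ?ltr_wpDl // => sd.
  by apply: le_lt_trans sd; rewrite ler_wpM2l // lerDl.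
apply: le_trans (ler_wpM2l c0 H) _.
rewrite [leLHS](_ : _ = e * `|s| * (normc c * normc h / K)); last by ring.
rewrite ler_piMr ?mulr_ge0 ?normr_ge0 ?ltW //.
by rewrite ltr_pdivrMr // mul1r /K ltrDl.
Qed.

Lemma normc_sqr_ReJ z : Re (conjc z * z) = normc z ^+ 2.
Proof. by rewrite normc_sqr; case: z => a b /=; ring. Qed.

Lemma ReB z w : Re (z - w) = Re z - Re w.
Proof. by case: z; case: w. Qed.

(** The mean value theorem fails for complex values. With v the vector to be bounded, it is applied
    to the real part of conj(v) times the function along the segment: the increment of this real
    function is exactly |v|^2, and one factor |v| is divided out. *)
Lemma complex_mvt f f' z w l (K : R) :
  (forall t : R, 0 <= t <= 1 -> let y := z + t%:C%C * (w - z) in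
     is_derive y 1 f (f' y) /\ normc (f' y - l) <= K) ->
  normc (f w - f z - l * (w - z)) <= K * normc (w - z).
Proof.
move=> H; set v := f w - f z - l * (w - z); set c := conjc v.
pose g (t : R) := Re (c * (f (z + t%:C%C * (w - z)))) - t * Re (c * l * (w - z)).
pose g' (t : R) := Re (c * (f' (z + t%:C%C * (w - z)) - l) * (w - z)).
have K0 : 0 <= K.
  have [|_] := H 0; first by rewrite lexx ler01.
  by apply: le_trans; exact: normc_ge0.
have D (t : R) : t \in `[0%R, 1%R] -> is_derive t 1 g (g' t).
  rewrite in_itv /= => /H [D _].
  have D1 := @is_derive_Re_line f c z (w - z) t _ D.
  have D2 : is_derive t 1 (fun t : R => t * Re (c * l * (w - z))) (Re (c * l * (w - z))).
    apply/is_deriveRP => e e0; exists 1 => // h _.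
    rewrite [X in `|X|](_ : _ = 0) ?normr0 ?mulr_ge0 ?normr_ge0 ?(ltW e0) //.
    by ring.
  have -> : g' t = Re (c * f' (z + t%:C%C * (w - z)) * (w - z)) - Re (c * l * (w - z)).
    by rewrite /g' -ReB; congr Re; ring.
  exact: is_deriveB.
have D' (x : R) : x \in `]0%R, 1%R[ -> is_derive x 1 g (g' x).
  by rewrite in_itv /= => /andP[x0 x1]; apply: D; rewrite in_itv /= !ltW.
have gc : {within `[0%R, 1%R], continuous g}.
  by apply: derivable_within_continuous => x xI; have [Dx _] := D x xI; exact: Dx.
have [s s01 gs] := @MVT R g g' 0 1 ltr01 D' gc.
have E : normc v ^+ 2 = g' s.
  have -> : g' s = g 1 - g 0 by rewrite gs subr0 mulr1.
  rewrite -normc_sqr_ReJ -/c /g !mul0r subr0 !mul1r addr0.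
  rewrite (addrC z) subrK -!ReB {1}/v.
  by congr Re; ring.
have [v0|v0] := eqVneq v 0; first by rewrite v0 normc0 mulr_ge0 // normc_ge0.
have vp : 0 < normc v by rewrite normc_gt0.
rewrite -(ler_pM2l vp) -expr2 E.
apply: le_trans (ler_norm _) _; apply: le_trans (Re_le_normc _) _.
rewrite !normcM normcJ mulrA ler_wpM2r ?normc_ge0 // ler_wpM2l ?(ltW vp) //.
have [|_ ->] := H s; last by [].
by move: s01; rewrite in_itv /= => /andP[? ?]; rewrite !ltW.
Qed.

Lemma is_derive0_ball f z (r : R) : (forall w, normc (w - z) < r -> is_derive w 1 f 0) ->
  forall w, normc (w - z) < r -> f w = f z.
Proof.
move=> H w wr.
have K : normc (f w - f z - 0 * (w - z)) <= 0 * normc (w - z).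
  apply: (@complex_mvt f (fun=> 0)) => t /andP[t0 t1] y.
  split; last by rewrite subrr normc0.
  apply: H; rewrite /y.
  rewrite addrAC subrr add0r normcM normc_Creal ger0_norm //.
  by apply: le_lt_trans wr; rewrite ler_piMl // normc_ge0.
apply/eqP; rewrite -subr_eq0 -normc_eq0 eq_le normc_ge0 andbT.
by move: K; rewrite !mul0r subr0.
Qed.

End ComplexDerivatives.

(** * The chain rule in the plane and the logarithm *)

Section Logarithm.
Variable R : realType.

Lemma rdiff_comp (F : R -> R -> R) (g : R -> R) (x y a b l : R) :
  rdiff F x y a b -> is_derive (F x y) 1 g l ->
  rdiff (fun x y => g (F x y)) x y (l * a) (l * b).
Proof.
move=> HF /is_deriveRP Hg e e0.
pose M := `|a| + `|b| + 1.
have a0 := normr_ge0 a; have b0 := normr_ge0 b; have l0 := normr_ge0 l.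
have M0 : 0 < M by rewrite /M; lra.
have e1 : 0 < e / (2 * M) by rewrite divr_gt0 // mulr_gt0.
have [d d0 {}Hg] := Hg _ e1.
(* Tolerance 1 makes the increment of [F] at most [M] times that of the arguments; the other bound
   absorbs the later multiplication by [l]. *)
have e2 : 0 < Num.min 1 (e / (2 * (`|l| + 1))).
  by rewrite lt_min ltr01 divr_gt0 // mulr_gt0 // ltr_wpDl.
have [d' d'0 {}HF] := HF _ e2.
exists (Num.min d' (d / (2 * M))).
  by rewrite lt_min d'0 divr_gt0 // mulr_gt0.
move=> h k; rewrite !lt_min => /andP[hd hM] /andP[kd kM].
have h0 := normr_ge0 h; have k0 := normr_ge0 k.
have {}HF := HF h k hd kd.
set D := F (x + h) (y + k) - F x y in HF *.
have HF1 : `|D - (a * h + b * k)| <= 1 * (`|h| + `|k|).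
  by apply: le_trans HF _; rewrite ler_wpM2r ?addr_ge0 // ge_min lexx.
have HF2 : `|D - (a * h + b * k)| <= e / (2 * (`|l| + 1)) * (`|h| + `|k|).
  by apply: le_trans HF _; rewrite ler_wpM2r ?addr_ge0 // ge_min lexx orbT.
have DM : `|D| <= M * (`|h| + `|k|).
  have -> : D = (D - (a * h + b * k)) + (a * h + b * k) by ring.
  apply: le_trans (ler_normD _ _) _.
  have := ler_normD (a * h) (b * k); rewrite !normrM => ab.
  apply: le_trans (lerD HF1 ab) _; rewrite /M; nra.
have Dd : `|D| < d.
  apply: le_lt_trans DM _.
  have : M * `|h| < d / 2.
    by rewrite -ltr_pdivlMl //; apply: lt_le_trans hM _; rewrite invfM mulrA mulrC.
  have : M * `|k| < d / 2.
    by rewrite -ltr_pdivlMl //; apply: lt_le_trans kM _; rewrite invfM mulrA mulrC.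
  lra.
have := Hg D Dd.
have -> : F x y + D = F (x + h) (y + k) by rewrite /D addrC subrK.
move=> {}Hg.
rewrite [X in `|X|](_ : _ = (g (F (x + h) (y + k)) - g (F x y) - l * D) + l * (D - (a * h + b * k))); last by ring.
apply: le_trans (ler_normD _ _) _; rewrite normrM.
have A1 : e / (2 * M) * `|D| <= e / 2 * (`|h| + `|k|).
  apply: le_trans (ler_wpM2l (ltW e1) DM) _.
  by rewrite invfM !mulrA divfK ?gt_eqF.
have A2 : `|l| * `|D - (a * h + b * k)| <= e / 2 * (`|h| + `|k|).
  apply: le_trans (ler_wpM2l l0 HF2) _.
  rewrite mulrA ler_wpM2r ?addr_ge0 // invfM.
  rewrite [leLHS](_ : _ = e / 2 * (`|l| / (`|l| + 1))); last by ring.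
  apply: ler_piMr; first by rewrite divr_ge0 // ltW.
  by rewrite ler_pdivrMr ?mul1r ?lerDl // ltr_wpDl.
lra.
Qed.

Lemma rdiffD (F G : R -> R -> R) (x y a b c d : R) :
  rdiff F x y a b -> rdiff G x y c d ->
  rdiff (fun x y => F x y + G x y) x y (a + c) (b + d).
Proof.
move=> HF HG e e0; have e2 : 0 < e / 2 by lra.
have [d1 d10 {}HF] := HF _ e2; have [d2 d20 {}HG] := HG _ e2.
exists (Num.min d1 d2); first by rewrite lt_min d10.
move=> h k; rewrite !lt_min => /andP[h1 h2] /andP[k1 k2].
rewrite [X in `|X|](_ : _ = (F (x + h) (y + k) - F x y - (a * h + b * k))
  + (G (x + h) (y + k) - G x y - (c * h + d * k))); last by ring.
apply: le_trans (ler_normD _ _) _.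
have := HF h k h1 k1; have := HG h k h2 k2; lra.
Qed.

(* The principal logarithm, but only on the right half-plane. *)
Definition clog (z : R[i]) : R[i] :=
  Complex (ln (Re z ^+ 2 + Im z ^+ 2) / 2) (atan ((Re z)^-1 * Im z)).

Lemma is_derive_clog (z : R[i]) : 0 < Re z -> is_derive z 1 clog z^-1.
Proof.
case: z => x y /= x0.
have x_neq0 : x != 0 by rewrite gt_eqF.
have n0 : 0 < x ^+ 2 + y ^+ 2 by rewrite ltr_pwDl ?exprn_gt0 // sqr_ge0.
have n_neq0 : x ^+ 2 + y ^+ 2 != 0 by rewrite gt_eqF.
have sq (t : R) : is_derive t 1 (fun t : R => t ^+ 2) (2 * t).
  have := @is_deriveX R R id 2 t 1 1 (is_derive_id t 1).
  have -> : (2%:R * id t ^+ 2.-1) *: 1 = 2 * t by rewrite [_ *: _]mulr1 expr1.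
  by rewrite exprfctE.
have c1 (t : R) : is_derive t 1 (fun=> 1 : R) 0 by exact: is_derive_cst.
have U : rdiff (fun x y => ln (x ^+ 2 + y ^+ 2) / 2) x y
   (x / (x ^+ 2 + y ^+ 2)) (y / (x ^+ 2 + y ^+ 2)).
  (* The factors 1 bring both squares into the separated form of [rdiff_sep]. *)
  have := @rdiff_comp (fun x y => x ^+ 2 * 1 + 1 * y ^+ 2) (fun t => ln t / 2) x y
    _ _ ((x ^+ 2 + y ^+ 2)^-1 / 2) (rdiffD (rdiff_sep (sq x) (c1 y)) (rdiff_sep (c1 x) (sq y))).
  rewrite mulr1 mul1r => /(_ _) H.
  suff -> : (fun x y => ln (x ^+ 2 + y ^+ 2) / 2) =
    (fun x y : R => ln (x ^+ 2 * 1 + 1 * y ^+ 2) / 2).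
    have -> : x / (x ^+ 2 + y ^+ 2) = (x ^+ 2 + y ^+ 2)^-1 / 2 * (2 * x * 1 + 0 * y ^+ 2) by field.
    have -> : y / (x ^+ 2 + y ^+ 2) = (x ^+ 2 + y ^+ 2)^-1 / 2 * (x ^+ 2 * 0 + 1 * (2 * y)) by field.
    apply: H.
    have L := is_derive1_ln n0.
    have -> : (fun t : R => ln t / 2) = 2^-1 *: (@ln R).
      by apply/funext => t; rewrite fctE mulrC.
    by rewrite mulrC; exact: is_deriveZ.
  by apply/funext => s; apply/funext => t; rewrite mulr1 mul1r.
have V : rdiff (fun x y => atan (x^-1 * y)) x y
   (- (y / (x ^+ 2 + y ^+ 2))) (x / (x ^+ 2 + y ^+ 2)).
  have iv : is_derive x 1 (fun x => x^-1) (- x ^- 2).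
    have := @is_deriveV R id x 1 1 x_neq0 (is_derive_id x 1).
    by rewrite [_ *: _]mulr1.
  have := rdiff_comp (rdiff_sep iv (is_derive_id y 1)) (is_derive1_atan _).
  congr rdiff; field.
    by rewrite n_neq0 x_neq0.
  by rewrite n_neq0 x_neq0.
rewrite -[y / (x ^+ 2 + y ^+ 2)]opprK in U.
have -> : (x +i* y)^-1%C = Complex (x / (x ^+ 2 + y ^+ 2)) (- (y / (x ^+ 2 + y ^+ 2))).
  by [].
exact: (@CR_is_derive R (fun x y => ln (x ^+ 2 + y ^+ 2) / 2) (fun x y => atan (x^-1 * y)) x y).
Qed.

End Logarithm.

(** * Goursat's theorem and the mean value property *)

Section Bisection.
Variable R : realType.
(* Goursat's bisection, for an arbitrary function of rectangles [a, b] x [c, d]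
   that is additive and vanishes to more than second order at every point. *)
Variables (J : R -> R -> R -> R -> R) (s1 s2 t1 t2 : R).
Hypotheses (hs : s1 <= s2) (ht : t1 <= t2).
Hypothesis Js : forall a m b c d, s1 <= a -> a <= m -> m <= b -> b <= s2 ->
  t1 <= c -> c <= d -> d <= t2 -> J a b c d = J a m c d + J m b c d.
Hypothesis Jt : forall a b c m d, s1 <= a -> a <= b -> b <= s2 ->
  t1 <= c -> c <= m -> m <= d -> d <= t2 -> J a b c d = J a b c m + J a b m d.
Hypothesis Jloc : forall s t, s1 <= s <= s2 -> t1 <= t <= t2 ->
  forall e : R, 0 < e -> exists2 r : R, 0 < r & forall a b c d,
  s1 <= a -> a <= s <= b -> b <= s2 -> t1 <= c -> c <= t <= d -> d <= t2 ->
  b - a < r -> d - c < r -> `|J a b c d| <= e * ((b - a) + (d - c)) ^+ 2.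

Let rect : Type := (R * R * (R * R))%type.
Let val (q : rect) := `|J q.1.1 q.1.2 q.2.1 q.2.2|.
Let lo (q : R * R) := (q.1, (q.1 + q.2) / 2).
Let hi (q : R * R) := ((q.1 + q.2) / 2, q.2).
(** A quarter carrying at least a fourth of |J|. The last one needs no test: if the other three
    fail, additivity forces it to qualify. *)
Let step (q : rect) : rect :=
  if val q / 4 <= val (lo q.1, lo q.2) then (lo q.1, lo q.2)
  else if val q / 4 <= val (lo q.1, hi q.2) then (lo q.1, hi q.2)
  else if val q / 4 <= val (hi q.1, lo q.2) then (hi q.1, lo q.2)
  else (hi q.1, hi q.2).
Let ok (q : rect) := [/\ s1 <= q.1.1, q.1.1 <= q.1.2, q.1.2 <= s2 &
  [/\ t1 <= q.2.1, q.2.1 <= q.2.2 & q.2.2 <= t2]].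

Let step_half (q : rect) : exists u v, [/\ step q = (u, v),
  u = lo q.1 \/ u = hi q.1 & v = lo q.2 \/ v = hi q.2].
Proof.
by rewrite /step; do !case: ifP => _; do 2 eexists; split; try reflexivity; by [left|right].
Qed.

Let step_ok q : ok q -> [/\ ok (step q), q.1.1 <= (step q).1.1,
  (step q).1.2 <= q.1.2, q.2.1 <= (step q).2.1 & (step q).2.2 <= q.2.2] /\
  [/\ (step q).1.2 - (step q).1.1 = (q.1.2 - q.1.1) / 2 &
      (step q).2.2 - (step q).2.1 = (q.2.2 - q.2.1) / 2].
Proof.
have [u [v [-> + +]]] := step_half q; case: q => [[a b] [c d]].
rewrite /lo /hi /ok /= => -[]-> -[]->; rewrite /=; move=> [? ? ? [? ? ?]]; do !split; lra.
Qed.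

Let step_val q : ok q -> val q / 4 <= val (step q).
Proof.
case: q => [[a b] [c d]]; rewrite /ok /= => -[? ? ? [? ? ?]].
rewrite /step; case: ifP => // /negbT; rewrite -ltNge => H1.
case: ifP => // /negbT; rewrite -ltNge => H2.
case: ifP => // /negbT; rewrite -ltNge => H3.
move: H1 H2 H3; rewrite /val /lo /hi /=.
have -> : J a b c d = J a ((a + b) / 2) c ((c + d) / 2) + J a ((a + b) / 2) ((c + d) / 2) d
   + (J ((a + b) / 2) b c ((c + d) / 2) + J ((a + b) / 2) b ((c + d) / 2) d).
  rewrite (@Js a ((a + b) / 2) b c d) //; try lra.
  by rewrite (@Jt a _ c ((c + d) / 2) d) ?(@Jt _ b c ((c + d) / 2) d) //; lra.
set A := J a _ c _; set B := J a _ _ d; set C := J _ b c _; set D := J _ b _ d.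
have := ler_normD (A + B) (C + D); have := ler_normD A B; have := ler_normD C D.
lra.
Qed.

Let q (n : nat) := iter n step ((s1, s2), (t1, t2)).

Let q_ok n : ok (q n).
Proof.
elim: n => [|n IH] /=; first by split=> //=; split.
by have [[]] := step_ok IH.
Qed.

Let q_width n : (q n).1.2 - (q n).1.1 = (s2 - s1) / 2 ^+ n /\
  (q n).2.2 - (q n).2.1 = (t2 - t1) / 2 ^+ n.
Proof.
elim: n => [|n [IH1 IH2]] /=; first by rewrite expr0 !divr1.
have [_ [-> ->]] := step_ok (q_ok n).
by rewrite IH1 IH2 exprSr invfM !mulrA.
Qed.

Let q_val n : val (q 0) / 4 ^+ n <= val (q n).
Proof.
elim: n => [|n IH]; first by rewrite expr0 divr1.
apply: le_trans (step_val (q_ok n)); rewrite exprSr invfM mulrA.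
by rewrite ler_pM2r // invr_gt0.
Qed.

Let q_mono m n : (m <= n)%N -> [/\ (q m).1.1 <= (q n).1.1,
  (q n).1.2 <= (q m).1.2, (q m).2.1 <= (q n).2.1 & (q n).2.2 <= (q m).2.2].
Proof.
move=> /subnK <-; elim: (n - m)%N => [|k [I1 I2 I3 I4]]; first by rewrite add0n.
have [[_ H1 H2 H3 H4] _] := step_ok (q_ok (k + m)).
by rewrite addSn; split; [apply: le_trans H1|apply: le_trans I2|apply: le_trans H3|apply: le_trans I4].
Qed.

Let nested (a b : nat -> R) :
  (forall m n, (m <= n)%N -> a m <= a n /\ b n <= b m) ->
  (forall n, a n <= b n) -> exists x, forall n, a n <= x <= b n.
Proof.
move=> mono ab; exists (sup (range a)) => n.
have le m k : a m <= b k.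
  have [mk|/ltnW km] := leqP m k.
    by have [H _] := mono _ _ mk; apply: le_trans (ab k).
  by have [_ H] := mono _ _ km; apply: le_trans H.
have ne : range a !=set0 by exists (a 0); exists 0.
apply/andP; split; last by apply: ge_sup => // _ [m _ <-].
by apply: ub_le_sup; [exists (b 0) => _ [m _ <-]|exists n].
Qed.

(** Each bisection keeps at least a fourth of |J| while the square of the half-perimeter is divided
    by exactly four. The local estimate at the common point of the nested rectangles therefore
    bounds |J| on the original one. The summand 1 in [L] keeps it positive for a degenerate
    rectangle. *)
Lemma rectangle_function_eq0 : J s1 s2 t1 t2 = 0.
Proof.
have [s Hs] : exists s, forall n, (q n).1.1 <= s <= (q n).1.2.
  apply: nested => [m n /q_mono[] //|n]; by have [] := q_ok n.
have [t Ht] : exists s, forall n, (q n).2.1 <= s <= (q n).2.2.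
  apply: nested => [m n /q_mono[] //|n]; by have [_ _ _ []] := q_ok n.
apply/eqP; rewrite -normr_le0; apply/ler_addgt0Pl => e e0; rewrite addr0.
pose L := (s2 - s1) + (t2 - t1) + 1.
have L0 : 0 < L by rewrite /L ltr_wpDl // addr_ge0 // subr_ge0.
have [r r0 Hr] := Jloc (Hs 0%N) (Ht 0%N) (divr_gt0 e0 (exprn_gt0 2 L0)).
have [n nr] : exists n : nat, L / 2 ^+ n < r.
  exists (Num.bound (L / r)); rewrite ltr_pdivrMr ?exprn_gt0 // -ltr_pdivrMl //.
  by rewrite mulrC; apply: upper_nthrootP.
have [w1 w2] := q_width n; have n0 : 0 < (2 : R) ^+ n by rewrite exprn_gt0.
have /andP[sa sb] := Hs n; have /andP[ta tb] := Ht n.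
have [k1 k2 k3 [k4 k5 k6]] := q_ok n.
have W1 : (s2 - s1) / 2 ^+ n < r.
  apply: le_lt_trans nr; rewrite ler_pM2r ?invr_gt0 // /L -addrA lerDl.
  by rewrite addr_ge0 // subr_ge0.
have W2 : (t2 - t1) / 2 ^+ n < r.
  apply: le_lt_trans nr; rewrite ler_pM2r ?invr_gt0 // /L addrAC lerDr.
  by rewrite addr_ge0 // subr_ge0.
have := Hr (q n).1.1 (q n).1.2 (q n).2.1 (q n).2.2; rewrite w1 w2 => {}Hr.
have {}Hr := Hr k1 (Hs n) k3 k4 (Ht n) k6 W1 W2.
have {Hr} := le_trans (q_val n) Hr.
rewrite -mulrDl expr_div_n ler_pdivrMr ?exprn_gt0 //.
have -> : (4 : R) ^+ n = (2 ^+ n) ^+ 2 by rewrite -exprM mulnC exprM; congr (_ ^+ _); ring.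
rewrite -mulrA divfK ?sqrf_eq0 ?gt_eqF //.
move=> H; apply: le_trans H _; rewrite mulrAC ler_pdivrMr ?exprn_gt0 //.
have uv0 : 0 <= s2 - s1 + (t2 - t1) by rewrite addr_ge0 // subr_ge0.
by rewrite ler_pM2l // ler_pXn2r ?nnegrE // ?(ltW L0) // /L lerDl.
Qed.

End Bisection.

(** * Integrals of continuous functions over segments *)

Section Integral.
Variable R : realType.
Notation mu := (@lebesgue_measure R).

Definition rint (a b : R) (f : R -> R) : R := Rintegral mu `[a, b] f.

(** Two-sided continuity, also at the endpoints: it restricts to subsegments at no cost, and is
    available because the integrands are differentiable at every point of the segment. *)
Definition cont_on (a b : R) (f : R -> R) : Prop :=
  forall x, a <= x <= b -> {for x, continuous f}.

Lemma cont_onS (a b c d : R) f : a <= c -> d <= b -> cont_on a b f -> cont_on c d f.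
Proof.
move=> ac db H x /andP[cx xd]; apply: H.
by rewrite (le_trans ac cx) (le_trans xd db).
Qed.

Lemma cont_onB (a b : R) f g : cont_on a b f -> cont_on a b g ->
  cont_on a b (fun x => f x - g x).
Proof. by move=> cf cg x xI; apply: continuousB; [exact: cf|exact: cg]. Qed.

Lemma cont_on_integrable (a b : R) f : cont_on a b f -> mu.-integrable `[a, b] (EFin \o f).
Proof.
move=> cf; apply: continuous_compact_integrable; first exact: segment_compact.
apply: continuous_in_subspaceT => x; rewrite inE /= in_itv /=; exact: cf.
Qed.

Lemma rint_ext (a b : R) f g : (forall x, a <= x <= b -> f x = g x) -> rint a b f = rint a b g.
Proof. by move=> H; apply: eq_Rintegral => x; rewrite inE /= in_itv /= => /H. Qed.

Lemma rint_cst (a b c : R) : a <= b -> rint a b (fun=> c) = c * (b - a).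
Proof.
move=> ab; rewrite /rint Rintegral_cst //; congr (_ * _).
by rewrite /= lebesgue_measure_itv /= lte_fin; case: ltgtP ab => //= -> _; rewrite subrr.
Qed.

Lemma rintD (a b : R) f g : cont_on a b f -> cont_on a b g ->
  rint a b (fun x => f x + g x) = rint a b f + rint a b g.
Proof. by move=> /cont_on_integrable cf /cont_on_integrable cg; exact: RintegralD. Qed.

Lemma rintD_ext (a b : R) h f g : cont_on a b f -> cont_on a b g ->
  (forall x, h x = f x + g x) -> rint a b h = rint a b f + rint a b g.
Proof.
move=> cf cg H; rewrite -rintD //; congr rint; exact/funext.
Qed.

Lemma rintB (a b : R) f g : cont_on a b f -> cont_on a b g ->
  rint a b (fun x => f x - g x) = rint a b f - rint a b g.
Proof. by move=> /cont_on_integrable cf /cont_on_integrable cg; exact: RintegralB. Qed.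

Lemma rintZ (a b c : R) f : cont_on a b f -> rint a b (fun x => c * f x) = c * rint a b f.
Proof. by move=> /cont_on_integrable cf; exact: RintegralZl. Qed.

Lemma rint_le (a b : R) f g : cont_on a b f -> cont_on a b g ->
  (forall x, a <= x <= b -> f x <= g x) -> rint a b f <= rint a b g.
Proof.
move=> /cont_on_integrable cf /cont_on_integrable cg H; apply: le_Rintegral => //.
Qed.

Lemma cont_on_cst (a b c : R) : cont_on a b (fun=> c).
Proof. by move=> x _; exact: cst_continuous. Qed.

Lemma rint_split (a m b : R) f : a <= m -> m <= b -> cont_on a b f ->
  rint a b f = rint a m f + rint m b f.
Proof.
move=> am mb cf.
have := @Rintegral_itvB R f (BLeft a) (BRight b) m (cont_on_integrable cf).
rewrite !bnd_simp => /(_ am mb) /eqP; rewrite subr_eq addrC => /eqP.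
rewrite /rint => ->; congr (_ + _); apply: Rintegral_itv_obnd_cbnd.
have := cont_on_integrable (cont_onS am (lexx b) cf).
by apply: integrableS => //; exact: subset_itv_oc_cc.
Qed.

Lemma rint_bound (a b K : R) f : a <= b -> cont_on a b f ->
  (forall x, a <= x <= b -> `|f x| <= K) -> `|rint a b f| <= K * (b - a).
Proof.
move=> ab cf H; rewrite ler_norml -mulNr -!(@rint_cst a b) //.
apply/andP; split; apply: rint_le; rewrite ?cf //; try exact: cont_on_cst.
  by move=> x /H; rewrite ler_norml => /andP[].
by move=> x /H; rewrite ler_norml => /andP[].
Qed.

Lemma rint_approx (a b c K : R) f : a <= b -> cont_on a b f ->
  (forall x, a <= x <= b -> `|f x - c| <= K) -> `|rint a b f - c * (b - a)| <= K * (b - a).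
Proof.
move=> ab cf H; rewrite -(@rint_cst a b) // -rintB //; last exact: cont_on_cst.
by apply: rint_bound => //; apply: cont_onB => //; exact: cont_on_cst.
Qed.

Lemma rdiff_cont (F : R -> R -> R) x y a b : rdiff F x y a b ->
  {for x, continuous (F^~ y)} /\ {for y, continuous (F x)}.
Proof.
move=> H; have [d d0 {}H] := H 1 ltr01.
pose M := `|a| + `|b| + 1.
have M0 : 0 < M by rewrite /M ltr_wpDl // addr_ge0.
have K (h k : R) : `|h| < d -> `|k| < d -> `|F (x + h) (y + k) - F x y| <= M * (`|h| + `|k|).
  move=> hd kd; have := H h k hd kd; rewrite mul1r => {}H.
  have -> : F (x + h) (y + k) - F x y =
    (F (x + h) (y + k) - F x y - (a * h + b * k)) + (a * h + b * k) by ring.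
  apply: le_trans (ler_normD _ _) _.
  have := ler_normD (a * h) (b * k); rewrite !normrM => ab.
  apply: le_trans (lerD H ab) _; rewrite /M.
  have := normr_ge0 a; have := normr_ge0 b; have := normr_ge0 h; have := normr_ge0 k.
  by nra.
have A (G : R -> R) (u : R) : (forall h, `|h| < d -> `|G (u + h) - G u| <= M * `|h|) ->
   {for u, continuous G}.
  move=> HG; apply/cvgrPdist_lt => e e0; apply/nearRP.
  exists (Num.min d (e / M)); first by rewrite lt_min d0 divr_gt0.
  move=> v; rewrite lt_min => /andP[vd ve]; rewrite distrC.
  have := HG (v - u) vd; rewrite (addrC u) subrK => /le_lt_trans; apply.
  by rewrite mulrC -ltr_pdivlMr.
split; apply: A => h hd.
  by have := K h 0 hd; rewrite normr0 !addr0 => /(_ d0).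
by have := K 0 h; rewrite normr0 !addr0 !add0r => /(_ d0 hd).
Qed.

End Integral.

(** * Goursat's theorem on a rectangle *)

Section Goursat.
Variable R : realType.

(* The 1-form A ds + B dt is closed, but its coefficients are only differentiable. *)
Lemma goursat (A B : R -> R -> R) (s1 s2 t1 t2 : R) : s1 <= s2 -> t1 <= t2 ->
  (forall s t, s1 <= s <= s2 -> t1 <= t <= t2 -> exists u v w : R,
     rdiff A s t u v /\ rdiff B s t v w) ->
  rint s1 s2 (fun s => A s t1 - A s t2) + rint t1 t2 (fun t => B s2 t - B s1 t) = 0.
Proof.
move=> hs ht H.
have cA s' s'' t : s1 <= s' -> s'' <= s2 -> t1 <= t <= t2 -> cont_on s' s'' (A^~ t).
  move=> h1 h2 tI s /andP[h3 h4]; have [||u [v [w [/rdiff_cont[cA _] _]]]] := H s t => //.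
  by rewrite (le_trans h1 h3) (le_trans h4 h2).
have cB t' t'' s : t1 <= t' -> t'' <= t2 -> s1 <= s <= s2 -> cont_on t' t'' (B s).
  move=> h1 h2 sI t /andP[h3 h4]; have [||u [v [w [_ /rdiff_cont[_ cB]]]]] := H s t => //.
  by rewrite (le_trans h1 h3) (le_trans h4 h2).
apply: (@rectangle_function_eq0 R (fun s1 s2 t1 t2 =>
  rint s1 s2 (fun s => A s t1 - A s t2) + rint t1 t2 (fun t => B s2 t - B s1 t))) => //.
- move=> a m b c d h1 h2 h3 h4 h5 h6 h7.
  have c1 : t1 <= c <= t2 by lra.
  have d1 : t1 <= d <= t2 by lra.
  rewrite (@rint_split _ a m b) //; last by apply: cont_onB; apply: cA.
  rewrite (@rintD_ext _ c d (fun t => B b t - B a t) (fun t => B m t - B a t)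
    (fun t => B b t - B m t)); first exact: addrACA.
  - by apply: cont_onB; apply: cB => //; lra.
  - by apply: cont_onB; apply: cB => //; lra.
  - by move=> x; ring.
- move=> a b c m d h1 h2 h3 h4 h5 h6 h7.
  have a1 : s1 <= a <= s2 by lra.
  have b1 : s1 <= b <= s2 by lra.
  rewrite (@rint_split _ c m d) //; last by apply: cont_onB; apply: cB.
  rewrite (@rintD_ext _ a b (fun s => A s c - A s d) (fun s => A s c - A s m)
    (fun s => A s m - A s d)); first exact: addrACA.
  - by apply: cont_onB; apply: cA => //; lra.
  - by apply: cont_onB; apply: cA => //; lra.
  - by move=> x; ring.
move=> s t sI tI e e0.
have [u [v [w [rA rB]]]] := H s t sI tI.
have e2 : 0 < e / 2 by lra.
have [d1 d10 {}rA] := rA _ e2; have [d2 d20 {}rB] := rB _ e2.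
exists (Num.min d1 d2); first by rewrite lt_min d10.
move=> a b c d h1 /andP[h2 h3] h4 k1 /andP[k2 k3] k4.
rewrite !lt_min => /andP[ba1 ba2] /andP[dc1 dc2].
have ab : a <= b by lra.
have cd : c <= d by lra.
pose L := (b - a) + (d - c).
have N (p q x r : R) : p <= x <= q -> p <= r <= q -> `|r - x| <= q - p.
  by move=> xI rI; rewrite ler_norml; apply/andP; split; lra.
have EA s' t' : a <= s' <= b -> c <= t' <= d ->
    `|A s' t' - A s t - (u * (s' - s) + v * (t' - t))| <= e / 2 * L.
  move=> s'I t'I.
  have hh : `|s' - s| <= b - a by apply: N => //; lra.
  have kk : `|t' - t| <= d - c by apply: N => //; lra.
  have := rA (s' - s) (t' - t) (le_lt_trans hh ba1) (le_lt_trans kk dc1).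
  rewrite !(addrC _ (_ - _)) !subrK => /le_trans; apply.
  by rewrite ler_pM2l // lerD.
have EB s' t' : a <= s' <= b -> c <= t' <= d ->
    `|B s' t' - B s t - (v * (s' - s) + w * (t' - t))| <= e / 2 * L.
  move=> s'I t'I.
  have hh : `|s' - s| <= b - a by apply: N => //; lra.
  have kk : `|t' - t| <= d - c by apply: N => //; lra.
  have := rB (s' - s) (t' - t) (le_lt_trans hh ba2) (le_lt_trans kk dc2).
  rewrite !(addrC _ (_ - _)) !subrK => /le_trans; apply.
  by rewrite ler_pM2l // lerD.
have cI : c <= c <= d by lra.
have dI : c <= d <= d by lra.
have aI : a <= a <= b by lra.
have bI : a <= b <= b by lra.
have IA : `|rint a b (fun s => A s c - A s d) - v * (c - d) * (b - a)| <= e * L * (b - a).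
  apply: rint_approx => //; first by apply: cont_onB; apply: cA => //; lra.
  move=> x xI; have Ec := EA x c xI cI; have Ed := EA x d xI dI.
  have := ler_normB (A x c - A s t - (u * (x - s) + v * (c - t)))
    (A x d - A s t - (u * (x - s) + v * (d - t))).
  rewrite [X in `|X| <= _](_ : _ = A x c - A x d - v * (c - d)); last by ring.
  move=> /le_trans; apply; lra.
have IB : `|rint c d (fun t => B b t - B a t) - v * (b - a) * (d - c)| <= e * L * (d - c).
  apply: rint_approx => //; first by apply: cont_onB; apply: cB => //; lra.
  move=> x xI; have Ec := EB b x bI xI; have Ed := EB a x aI xI.
  have := ler_normB (B b x - B s t - (v * (b - s) + w * (x - t)))
    (B a x - B s t - (v * (a - s) + w * (x - t))).
  rewrite [X in `|X| <= _](_ : _ = B b x - B a x - v * (b - a)); last by ring.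
  move=> /le_trans; apply; lra.
(* Closedness enters here: the partial derivative of [A] in t and that of [B] in s are the same [v],
   so the two main terms cancel and only the errors remain. *)
rewrite [X in `|X|](_ : _ = (rint a b (fun s => A s c - A s d) - v * (c - d) * (b - a))
  + (rint c d (fun t => B b t - B a t) - v * (b - a) * (d - c))); last by ring.
apply: le_trans (ler_normD _ _) _; apply: le_trans (lerD IA IB) _.
by rewrite -mulrDr -/L -mulrA -expr2.
Qed.

End Goursat.

(** * Mean values over the unit circle *)

Section MeanValue.
Variable R : realType.
Implicit Types (F G : R[i] -> R[i]) (z l : R[i]).

Definition circ (t : R) : R[i] := Complex (cos t) (sin t).

Lemma normc_circ t : normc (circ t) = 1.
Proof. by rewrite /= cos2Dsin2 sqrtr1. Qed.

Lemma cexp_circ (s t : R) : cexp (s +i* t)%C = (expR s)%:C%C * circ t.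
Proof. by rewrite /cexp /circ /=; congr Complex; ring. Qed.

Lemma pi2_gt0 : 0 < 2 * pi :> R.
Proof. by rewrite mulr_gt0 // pi_gt0. Qed.

Lemma circ_cont (t e : R) : 0 < e -> \forall s \near t, normc (circ s - circ t) < e.
Proof.
move=> e0; have e2 : 0 < e / 2 by lra.
have := @continuous_cos R t; have := @continuous_sin R t.
move=> /cvgrPdist_lt/(_ _ e2) S /cvgrPdist_lt/(_ _ e2) C.
near=> s; apply: le_lt_trans (normc_le_ReIm _) _ => /=.
have : `|cos t - cos s| < e / 2 by near: s.
have : `|sin t - sin s| < e / 2 by near: s.
by rewrite (distrC (sin t)) (distrC (cos t)); lra.
Unshelve. all: by end_near. Qed.

Definition cont_circ F : Prop := forall z, normc z = 1 -> {for z, continuous F}.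

Lemma cont_circ_ReIm F (a b : R) : cont_circ F ->
  cont_on a b (fun t => Re (F (circ t))) /\ cont_on a b (fun t => Im (F (circ t))).
Proof.
move=> cF; split => t _; apply/cvgrPdist_lt => e e0.
all: have /continuousCP/(_ e e0)[d d0 H] := cF _ (normc_circ t).
all: near=> s; rewrite distrC.
all: have /H Hs : normc (circ s - circ t) < d by near: s; exact: circ_cont.
  by rewrite -ReB; exact: le_lt_trans (Re_le_normc _) Hs.
have -> : Im (F (circ s)) - Im (F (circ t)) = Im (F (circ s) - F (circ t)).
  by case: (F _) => ? ?; case: (F _).
exact: le_lt_trans (Im_le_normc _) Hs.
Unshelve. all: by end_near. Qed.

Definition rmean (f : R -> R) : R := (2 * pi)^-1 * rint 0 (2 * pi) f.

Definition cmean F : R[i] :=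
  Complex (rmean (fun t => Re (F (circ t)))) (rmean (fun t => Im (F (circ t)))).

Lemma ler0pi2 : 0 <= 2 * pi :> R. Proof. exact: ltW pi2_gt0. Qed.

Lemma rmean_approx (f : R -> R) (c K : R) : cont_on 0 (2 * pi) f ->
  (forall t, `|f t - c| <= K) -> `|rmean f - c| <= K.
Proof.
move=> cf H; have := rint_approx ler0pi2 cf (fun x _ => H x).
rewrite subr0 => H2.
have p0 := pi2_gt0.
rewrite -(ler_pM2r p0); apply: le_trans H2.
rewrite -[X in _ * X](ger0_norm ler0pi2) -normrM mulrBl /rmean mulrAC mulVf ?mul1r //.
by rewrite gt_eqF.
Qed.

(** The factor 2 comes from bounding real and imaginary parts separately; it only affects the choice
    of constants below. *)
Lemma cmean_bound F (K : R) : cont_circ F -> (forall z, normc z = 1 -> normc (F z) <= K) ->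
  normc (cmean F) <= 2 * K.
Proof.
move=> /(@cont_circ_ReIm F 0 (2 * pi))[cR cI] H.
apply: le_trans (normc_le_ReIm _) _; rewrite mulr_natl mulr2n /=.
apply: lerD; rewrite -[X in `|X|]subr0; apply: rmean_approx => // t; rewrite subr0.
  by apply: le_trans (Re_le_normc _) (H _ (normc_circ t)).
by apply: le_trans (Im_le_normc _) (H _ (normc_circ t)).
Qed.

Lemma cmeanB F G : cont_circ F -> cont_circ G ->
  cmean (fun z => F z - G z) = cmean F - cmean G.
Proof.
move=> /(@cont_circ_ReIm F 0 (2 * pi))[cRF cIF] /(@cont_circ_ReIm G 0 (2 * pi))[cRG cIG].
have -> : cmean F - cmean G = Complex (Re (cmean F) - Re (cmean G)) (Im (cmean F) - Im (cmean G)) by [].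
rewrite /cmean; congr Complex; rewrite /rmean -mulrBr -rintB //; congr (_ * _).
  by apply: rint_ext => t _; rewrite ReB.
by apply: rint_ext => t _; case: (F _) => ? ?; case: (G _).
Qed.

Lemma eq_cmean F G : (forall z, normc z = 1 -> F z = G z) -> cmean F = cmean G.
Proof.
by move=> H; congr Complex; congr (_ * _); apply: rint_ext => t _; rewrite H ?normc_circ.
Qed.

Lemma cmeanZ (c : R[i]) F : cont_circ F -> cmean (fun z => c * F z) = c * cmean F.
Proof.
move=> /(@cont_circ_ReIm F 0 (2 * pi))[cRF cIF].
case: c => a b; rewrite /cmean /rmean.
have Z (c d : R) (f g : R -> R) h : cont_on 0 (2 * pi) f -> cont_on 0 (2 * pi) g ->
   (forall t, h t = c * f t + d * g t) ->
   rint 0 (2 * pi) h = c * rint 0 (2 * pi) f + d * rint 0 (2 * pi) g.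
  move=> cf cg hE; rewrite -!rintZ //; apply: rintD_ext => //.
    by move=> x xI; apply: continuousM; [exact: cst_continuous|exact: cf].
  by move=> x xI; apply: continuousM; [exact: cst_continuous|exact: cg].
have E (x y : R) : Complex a b * Complex x y = Complex (a * x - b * y) (a * y + b * x) by [].
rewrite E; congr Complex.
  rewrite (Z a (- b) _ _ (fun t => Re (Complex a b * F (circ t))) cRF cIF); first by ring.
  by move=> t; case: (F _) => x y /=; ring.
rewrite (Z b a _ _ (fun t => Im (Complex a b * F (circ t))) cRF cIF); first by ring.
by move=> t; case: (F _) => x y /=; ring.
Qed.

Lemma cont_derivable F z l : is_derive z 1 F l -> {for z, continuous F}.
Proof. by case=> D _; apply: differentiable_continuous; apply/derivable1_diffP. Qed.

(* The integrals over the two horizontal sides cancel by periodicity. *)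
Lemma periodic_strip G (s1 s2 T : R) : s1 <= s2 -> 0 <= T ->
  (forall s t, s1 <= s <= s2 -> exists l, is_derive (s +i* t)%C 1 G l) ->
  (forall s, G (s +i* T)%C = G (s +i* 0)%C) ->
  rint 0 T (fun t => Re (G (s2 +i* t)%C) - Re (G (s1 +i* t)%C)) = 0.
Proof.
move=> s12 T0 dG per.
have := @goursat R (fun s t => Im (G (s +i* t)%C)) (fun s t => Re (G (s +i* t)%C)) s1 s2 0 T s12 T0.
rewrite (@rint_ext _ s1 s2 _ (fun=> 0)); last by move=> s _; rewrite per subrr.
rewrite rint_cst // mul0r add0r; apply=> s t sI tI.
have [l /rdiff_ReIm[rR rI]] := dG s t sI.
by exists (Im l), (Re l), (- Im l).
Qed.

Lemma cos_2pi : cos (2 * pi) = 1 :> R.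
Proof. by rewrite mulr_natl -[_ *+ 2]add0r cosD2pi cos0. Qed.

Lemma sin_2pi : sin (2 * pi) = 0 :> R.
Proof. by rewrite mulr_natl -[_ *+ 2]add0r sinD2pi sin0. Qed.

(** In the coordinate log z, the annulus between radii r and 1 is a strip on which F(exp) is
    periodic, so the means over both circles agree; continuity at 0 then compares the small circle
    with F(0). No derivative at 0 is asked for, since the lemma will be applied to difference
    quotients. *)
Lemma Re_mean_value F :
  (forall z, 0 < normc z <= 1 -> exists l, is_derive z 1 F l) ->
  {for 0, continuous F} -> rmean (fun t => Re (F (circ t))) = Re (F 0).
Proof.
move=> dF cF; apply/eqP; rewrite -subr_eq0 -normr_le0; apply/ler_addgt0Pl => e e0.
rewrite addr0.
have [d d0 Hd] := (iffLR (continuousCP F 0) cF) e e0.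
pose r := Num.min 1 (d / 2).
have r0 : 0 < r by rewrite lt_min ltr01 divr_gt0.
have r1 : r <= 1 by rewrite ge_min lexx.
have rd : r < d by rewrite gt_min [X in _ || X](_ : _ = true) ?orbT //; lra.
have ln0 : ln r <= 0 by exact: ln_le0.
have dG s t : s <= 0 -> exists l, is_derive (s +i* t)%C 1 (F \o @cexp R) l.
  move=> s0; have [|l Fl] := dF (cexp (s +i* t)%C).
    by rewrite normc_cexp expR_gt0 /= -expR0 ler_expR.
  exists (l * cexp (s +i* t)%C).
  exact: (is_derive_compC (is_derive_cexp _) Fl).
have H := @periodic_strip (F \o @cexp R) (ln r) 0 (2 * pi) ln0 ler0pi2 _ _.
have {}H : rint 0 (2 * pi) (fun t => Re (F (circ t)) - Re (F (r%:C%C * circ t))) = 0.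
  rewrite -[RHS]H.
  - apply: rint_ext => t _ /=.
    by rewrite !cexp_circ expR0 mul1r lnK ?posrE.
  - by move=> s t /andP[_ s0]; exact: dG.
  - move=> s /=; rewrite !cexp_circ; congr (F (_ * _)).
    by rewrite /circ cos_2pi sin_2pi cos0 sin0.
have c1 : cont_on 0 (2 * pi) (fun t => Re (F (circ t))).
  apply: (proj1 (cont_circ_ReIm _ _ _)) => z z1.
  by have [|l /cont_derivable] := dF z; rewrite ?z1 ?ltr01 ?lexx.
have c2 : cont_on 0 (2 * pi) (fun t => Re (F (r%:C%C * circ t))).
  move=> t _; have [l D] := dG (ln r) t ln0.
  have [rR _] := rdiff_ReIm D; have [_] := rdiff_cont rR.
  have -> : (fun y : R => Re ((F \o @cexp R) (ln r +i* y)%C)) =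
    (fun t => Re (F (r%:C%C * circ t))).
    by apply/funext => u; rewrite /comp cexp_circ lnK.
  by [].
move: H; rewrite rintB // => /eqP; rewrite subr_eq0 => /eqP H.
rewrite /rmean H; apply: rmean_approx => // t; apply/ltW.
rewrite -ReB; apply: le_lt_trans (Re_le_normc _) (Hd _ _).
by rewrite subr0 normcM normc_circ mulr1 normc_Creal gtr0_norm.
Qed.

Lemma mean_value F :
  (forall z, 0 < normc z <= 1 -> exists l, is_derive z 1 F l) ->
  {for 0, continuous F} -> cmean F = F 0.
Proof.
move=> dF cF.
have -> : F 0 = Complex (Re (F 0)) (Im (F 0)) by case: (F 0).
congr Complex; first exact: Re_mean_value.
have ImE z : Im z = Re (- 'i%C * z) :> R by case: z => a b /=; ring.
rewrite ImE -(@Re_mean_value (fun z => - 'i%C * F z)).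
- by congr (_ * _); apply: rint_ext => t _; rewrite ImE.
- move=> z /dF[l D]; exists (- 'i%C * l); exact: is_deriveZ.
- by apply: continuousM; [exact: cst_continuous|exact: cF].
Qed.

End MeanValue.

(** * Entire functions *)

Section Entire.
Variable R : realType.
Implicit Types (f g F G : R[i] -> R[i]) (z w l : R[i]).

Lemma ler_dist_normc z w : `|normc z - normc w| <= normc (z - w).
Proof.
rewrite ler_norml; apply/andP; split.
  rewrite lerBrDl lerBlDr normcB; have := le_normcD (w - z) z.
  by rewrite subrK addrC.
by rewrite lerBlDr; have := le_normcD (z - w) w; rewrite subrK.
Qed.

Lemma normc_continuous : continuous (@normc R).
Proof.
move=> z; have FF : Filter (nbhs z) by exact: nbhs_filter.
apply/cvgrPdist_lt => e e0; apply/nearCP; exists e => // w wz.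
by apply: le_lt_trans (ler_dist_normc _ _) _; rewrite normcB.
Qed.

Lemma compact_disc (r : R) : compact [set z : R[i] | normc z <= r].
Proof.
pose i (p : R * R) : R[i] := Complex p.1 p.2.
have ic : continuous i.
  move=> p; have FF : Filter (nbhs p) by exact: nbhs_filter.
  apply/(cvgCP FF i (i p)) => e e0.
  have e2 : 0 < e / 2 by lra.
  apply/nbhs_ballP; exists (e / 2) => // q [q1 q2].
  apply: le_lt_trans (normc_le_ReIm _) _ => /=.
  move: q1 q2; rewrite /ball /= (distrC p.1) (distrC p.2); lra.
apply: (@subclosed_compact _ _ (i @` (`[- r, r] `*` `[- r, r]))).
- have -> : [set z : R[i] | normc z <= r] = @normc R @^-1` [set x | x <= r] by [].
  by apply: preimage_closed; [move=> x _; exact: normc_continuous|exact: closed_le].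
- apply: continuous_compact; first by apply: continuous_subspaceT.
  by apply: compact_setX; exact: segment_compact.
- case=> a b /= zr; exists (a, b) => //; split; rewrite /= in_itv /= -ler_norml.
    exact: le_trans (Re_le_normc (a +i* b)%C) zr.
  exact: le_trans (Im_le_normc (a +i* b)%C) zr.
Qed.

(** Uniformity in [z], from compactness of the disc, is what allows estimates on integrands to pass
    to circle means. *)
Lemma uniform_near f w (r e : R) : continuous f -> 0 < e ->
  exists2 d : R, 0 < d & forall h z, normc h < d -> normc z <= r ->
    normc (f (w + h + z) - f (w + z)) < e.
Proof.
move=> cf e0.
pose P h z := normc (f (w + h + z) - f (w + z)) < e.
have FF : Filter (nbhs (0 : R[i])) by exact: nbhs_filter.
have H := iffLR (compact_near_coveringP _) (@compact_disc r) _ _ P FF.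
suff : forall z, normc z <= r -> \forall z' \near z & h \near (0 : R[i]), P h z'.
  move=> /H /nearCP[d d0 {}H]; exists d => // h z hd zr.
  by apply: (H h) => //; rewrite subr0.
move=> z _ {H}.
have e2 : 0 < e / 2 by lra.
have [d d0 Hd] := (iffLR (continuousCP f (w + z)) (cf _)) _ e2.
exists ([set y | normc (y - z) < d / 2], [set h | normc (h - 0) < d / 2]) => /=.
  by split; apply/nearCP; exists (d / 2); rewrite // divr_gt0.
case=> y h /= [yz]; rewrite subr0 /P => hd.
have -> : f (w + h + y) - f (w + y) = (f (w + h + y) - f (w + z)) - (f (w + y) - f (w + z)) by ring.
apply: le_lt_trans (le_normcD _ _) _; rewrite normcN.
have : normc (f (w + h + y) - f (w + z)) < e / 2.
  apply: Hd; have -> : w + h + y - (w + z) = h + (y - z) by ring.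
  by apply: le_lt_trans (le_normcD _ _) _; lra.
have : normc (f (w + y) - f (w + z)) < e / 2.
  apply: Hd; have -> : w + y - (w + z) = y - z by ring.
  lra.
lra.
Qed.

Definition dC f z : R[i] := 'D_1 f z.

Lemma entireP f : entire f -> forall z, is_derive z 1 f (dC f z).
Proof. by move=> ef z; apply: derivableP; exact: ef. Qed.

Lemma entire_continuous f : entire f -> continuous f.
Proof. by move=> /entireP df z; exact: cont_derivable (df z). Qed.

Definition dquot f w z : R[i] := if z == w then dC f w else (f z - f w) / (z - w).

Lemma dquotE f w : dquot f w w = dC f w.
Proof. by rewrite /dquot eqxx. Qed.

Lemma dquot_derivable f w z : entire f -> z != w -> derivable (dquot f w) z 1.
Proof.
move=> ef zw; have zw0 : z - w != 0 by rewrite subr_eq0.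
apply: (@near_eq_derivable _ _ _ (fun z => (f z - f w) * (z - w)^-1)).
  apply/nearCP; exists (normc (z - w)); first by rewrite normc_gt0.
  move=> y yz; rewrite /dquot; case: eqVneq => // yw.
  by move: yz; rewrite yw normcB ltxx.
apply: derivableM; first by apply: derivableB; [exact: ef|exact: derivable_cst].
apply: derivableV => //.
Qed.

Lemma dquot_continuous f w : entire f -> {for w, continuous (dquot f w)}.
Proof.
move=> ef; apply/continuousCP => e e0; have e2 : 0 < e / 2 by lra.
have [d d0 Hd] := (iffLR (is_deriveCP _ _ _) (entireP ef w)) _ e2.
exists d => // y yd; rewrite dquotE /dquot.
case: eqVneq => [_|yw]; first by rewrite subrr normc0.
have yw0 : y - w != 0 by rewrite subr_eq0.
have := Hd _ yd; rewrite (addrC w) subrK => H.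
have -> : (f y - f w) / (y - w) - dC f w = (f y - f w - dC f w * (y - w)) / (y - w) by field.
have n0 : 0 < normc (y - w) by rewrite normc_gt0.
rewrite normcM normcV ltr_pdivrMr //; apply: le_lt_trans H _.
by rewrite ltr_pM2r //; lra.
Qed.

Lemma cont_circ_quot g (c : R[i]) : continuous g -> cont_circ (fun z => (g z - c) / z).
Proof.
move=> cg z z1; apply: continuousM.
  by apply: continuousB; [exact: cg|exact: cst_continuous].
by apply: continuousV; [rewrite -normc_gt0 z1 ltr01|].
Qed.

(* The integrand depends only on the values of f, hence the regularity of f'. *)
Lemma derivative_mean f w : entire f ->
  dC f w = cmean (fun z => (f (w + z) - f w) / z).
Proof.
move=> ef; have := @mean_value R (fun z => dquot f w (w + z)).
rewrite addr0 dquotE => <-.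
- apply: eq_cmean => z z1; have z0 : z != 0 by rewrite -normc_gt0 z1.
  by rewrite /dquot -subr_eq0 addrAC subrr add0r (negbTE z0).
- move=> z /andP[z0 _].
  have zw : w + z != w by rewrite -subr_eq0 addrAC subrr add0r -normc_gt0.
  have /derivableP D := dquot_derivable ef zw.
  have I : is_derive z 1 (fun z => w + z) 1.
    have := is_deriveD (is_derive_cst w z 1) (is_derive_id z 1).
    by rewrite add0r.
  by eexists; exact: (is_derive_compC I D).
- apply: (@continuous_comp _ _ _ (fun z => w + z) (dquot f w)).
    by apply: continuousD; [exact: cst_continuous|].
  by rewrite addr0; exact: dquot_continuous.
Qed.

End Entire.

(** * Regularity of the derivative, the maximum principle and isolated zeros *)

Section IsolatedZeros.
Variable R : realType.
Implicit Types (f g F G : R[i] -> R[i]) (z w l : R[i]).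

Lemma continuous_shift f w : continuous f -> continuous (fun z => f (w + z)).
Proof.
move=> cf z; apply: (@continuous_comp _ _ _ (fun z => w + z) f); last exact: cf.
by apply: continuousD; [exact: cst_continuous|].
Qed.

(** The integrands of [derivative_mean] at two close points differ by two increments of [f], each
    below e/8; [cmean_bound] doubles their sum to e/2. *)
Lemma dC_continuous f : entire f -> continuous (dC f).
Proof.
move=> ef w; apply/continuousCP => e e0.
have cf := entire_continuous ef.
have e8 : 0 < e / 8 by lra.
have [d d0 Hd] := uniform_near w 1 cf e8.
exists d => // y yd; rewrite !derivative_mean // -cmeanB; try exact/cont_circ_quot/continuous_shift.
have yE : y = w + (y - w) by ring.
apply: (@le_lt_trans _ _ (2 * (e / 4))); last by lra.
apply: cmean_bound.
  by move=> z z1; apply: continuousB; apply: cont_circ_quot z1; exact: continuous_shift.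
move=> z z1; have z0 : z != 0 by rewrite -normc_gt0 z1.
have -> : (f (y + z) - f y) / z - (f (w + z) - f w) / z =
  ((f (w + (y - w) + z) - f (w + z)) - (f (w + (y - w) + 0) - f (w + 0))) / z.
  by rewrite addr0 -yE addr0; field.
rewrite normcM normcV z1 invr1 mulr1; apply: le_trans (le_normcD _ _) _; rewrite normcN.
have := Hd (y - w) z yd; rewrite z1 => /(_ (lexx _)) A.
have := Hd (y - w) 0 yd; rewrite normc0 => /(_ ler01) B.
lra.
Qed.

(** Differentiation under the mean, which gives [L] as the candidate. The remainder [rem] is uniform
    on the disc by [complex_mvt] and the continuity of f'. It enters twice, at z and at 0, and
    [cmean_bound] doubles the result, whence e/4. *)
Lemma dC_entire f : entire f -> entire (dC f).
Proof.
move=> ef w; set L := cmean (fun z => (dC f (w + z) - dC f w) / z).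
suff [D _] : is_derive w 1 (dC f) L by [].
apply/is_deriveCP => e e0; have e4 : 0 < e / 4 by lra.
have cf := entire_continuous ef; have cdf := dC_continuous ef.
have [d d0 Hd] := uniform_near w 1 cdf e4.
have rem h z : normc h < d -> normc z <= 1 ->
    normc (f (w + h + z) - f (w + z) - dC f (w + z) * h) <= e / 4 * normc h.
  move=> hd z1; have hE : h = w + h + z - (w + z) by ring.
  rewrite {2 3}hE; apply: (@complex_mvt R f (dC f)) => t /andP[t0 t1] y.
  split; first exact: entireP.
  have -> : y = w + t%:C%C * h + z by rewrite /y -hE; ring.
  apply: ltW; apply: Hd => //; rewrite normcM normc_Creal ger0_norm //.
  by apply: le_lt_trans hd; rewrite ler_piMl // normc_ge0.
exists d => // h hd.
have c1 : cont_circ (fun z => (f (w + h + z) - f (w + h)) / z).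
  exact/cont_circ_quot/continuous_shift.
have c2 : cont_circ (fun z => (f (w + z) - f w) / z).
  exact/cont_circ_quot/continuous_shift.
have c3 : cont_circ (fun z => (dC f (w + z) - dC f w) / z).
  exact/cont_circ_quot/continuous_shift.
have c4 : cont_circ (fun z => h * ((dC f (w + z) - dC f w) / z)).
  by move=> z z1; apply: continuousM; [exact: cst_continuous|exact: c3].
have c5 : cont_circ (fun z => (f (w + h + z) - f (w + h)) / z - (f (w + z) - f w) / z).
  by move=> z z1; apply: continuousB; [exact: c1|exact: c2].
have E := cmeanB c5 c4; rewrite (cmeanB c1 c2) (cmeanZ h c3) in E.
rewrite (derivative_mean (w + h) ef) (derivative_mean w ef) (mulrC L) -E {E}.
have -> : e * normc h = 2 * (e / 2 * normc h) by field.
apply: cmean_bound.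
  by move=> z z1; apply: continuousB; [exact: c5|exact: c4].
move=> z z1; have z0 : z != 0 by rewrite -normc_gt0 z1.
have K (a b c b1 p q : R[i]) : (a - b) / z - (c - b1) / z - h * ((p - q) / z) =
  ((a - c - p * h) - (b - b1 - q * h)) / z by field.
rewrite K normcM normcV z1 invr1 mulr1; apply: le_trans (le_normcD _ _) _; rewrite normcN.
have A : normc z <= 1 by rewrite z1.
have B : normc (0 : R[i]) <= 1 by rewrite normc0.
have A1 := rem h z hd A; have B1 := rem h 0 hd B; rewrite (addr0 (w + h)) (addr0 w) in B1.
apply: le_trans (lerD A1 B1) _.
have -> : e / 4 * normc h + e / 4 * normc h = e / 2 * normc h by field.
exact: lexx.
Qed.

(** Only the point [w] is at stake, where the derivative must be f''(w)/2. Removing the quadratic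
    Taylor term gives [F], and the first-order expansion of f' at [w] bounds F' - f'(w) by e|h|;
    [complex_mvt] turns this into an error e|h|^2, and division by h leaves e|h|. *)
Lemma dquot_entire f w : entire f -> entire (dquot f w).
Proof.
move=> ef z; have [->{z}|zw] := eqVneq z w; last exact: dquot_derivable.
have edf := dC_entire ef.
suff [D _] : is_derive w 1 (dquot f w) (dC (dC f) w / 2) by [].
apply/is_deriveCP => e e0.
have [d d0 Hd] := (iffLR (is_deriveCP _ _ _) (entireP edf w)) _ e0.
exists d => // h hd; rewrite dquotE.
have [->|h0] := eqVneq h 0; first by rewrite addr0 dquotE mulr0 subrr subr0 normc0 mulr0.
have hE : w + h - w = h by ring.
have wh : w + h != w by rewrite -subr_eq0 hE.
rewrite /dquot (negbTE wh) hE.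
set a := dC (dC f) w in Hd *.
pose F z := f z - a / 2 * (z - w) ^+ 2.
pose F' z := dC f z - a * (z - w).
have dF z : is_derive z 1 F (F' z).
  have I : is_derive z 1 (fun z => z - w) 1.
    have := is_deriveB (is_derive_id z 1) (is_derive_cst w z 1).
    by rewrite subr0.
  have I2 := is_deriveM I I.
  have I3 := is_deriveZ (a / 2) I2.
  have := is_deriveB (entireP ef z) I3.
  have -> : f - (a / 2) *: ((fun z => z - w) * (fun z => z - w)) = F.
    by apply/funext => u; rewrite /F expr2.
  suff -> : dC f z - (a / 2) *: ((z - w) *: 1 + (z - w) *: 1) = F' z by [].
  have S (u v : R[i]) : u *: v = u * v by [].
  by rewrite /F' !S; field.
have := @complex_mvt R F F' w (w + h) (dC f w) (e * normc h).
rewrite hE => H.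
have {}H : normc (F (w + h) - F w - dC f w * h) <= e * normc h * normc h.
  apply: H => t /andP[t0 t1] y; split; first exact: dF.
  have -> : F' y - dC f w = dC f (w + t%:C%C * h) - dC f w - a * (t%:C%C * h).
    have yE : y - w = t%:C%C * h by rewrite /y addrAC subrr add0r.
    by rewrite /F' yE addrAC.
  have th : normc (t%:C%C * h) <= normc h.
    by rewrite normcM normc_Creal ger0_norm // ler_piMl // normc_ge0.
  apply: le_trans (Hd _ (le_lt_trans th hd)) _.
  by rewrite ler_pM2l.
have -> : (f (w + h) - f w) / h - dC f w - a / 2 * h = (F (w + h) - F w - dC f w * h) / h.
  by rewrite /F hE; field.
have hp : 0 < normc h by rewrite normc_gt0.
by rewrite normcM normcV ler_pdivrMr.
Qed.

Lemma max_modulus f (r M : R) : entire f -> 0 < r ->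
  (forall z, normc z = r -> normc (f z) <= M) ->
  forall z, normc z <= r -> normc (f z) <= M.
Proof.
move=> ef r0 HM z0 z0r.
have M0 : 0 <= M.
  apply: le_trans (normc_ge0 (f r%:C%C)) (HM _ _).
  by rewrite normc_Creal gtr0_norm.
have cf := entire_continuous ef.
rewrite -(ler_pXn2r (ltn0Sn 1)) ?nnegrE ?normc_ge0 //.
apply/ler_addgt0Pr => e e0.
(* |f|^2 + k |z|^2 is strictly subharmonic, so its maximum is on the circle. *)
pose k := e / r ^+ 2; have k0 : 0 < k by rewrite divr_gt0 // exprn_gt0.
pose h z := normc (f z) ^+ 2 + k * normc z ^+ 2.
have nc : continuous (@normc R) by exact: normc_continuous.
have hc : continuous h.
  move=> z; have nz : {for z, continuous (fun z => normc z ^+ 2)}.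
    have -> : (fun z : R[i] => normc z ^+ 2) = (fun z => normc z * normc z) by [].
    by apply: continuousM; exact: nc.
  have nfz : {for z, continuous (fun z => normc (f z))}.
    by apply: (@continuous_comp _ _ _ f (@normc R)); [exact: cf|exact: nc].
  apply: (@continuousD _ _ _ (fun z => normc (f z) ^+ 2) (fun z => k * normc z ^+ 2)).
    have -> : (fun z : R[i] => normc (f z) ^+ 2) = (fun z => normc (f z) * normc (f z)) by [].
    by apply: continuousM.
  by apply: continuousM; [exact: cst_continuous|exact: nz].
have [||c] := @compact_EVT_max _ R h _ _ (@compact_disc R r).
- by exists z0.
- exact: continuous_subspaceT.
rewrite inE /= => cr Hc.
have h0c : h z0 <= h c by apply: Hc; rewrite inE.
have [c_lt|c_eq] := ltP (normc c) r; last first.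
  have cE : normc c = r by apply/eqP; rewrite eq_le cr c_eq.
  have := HM c cE => fcM.
  have A : normc (f c) ^+ 2 <= M ^+ 2 by rewrite ler_pXn2r ?nnegrE ?normc_ge0.
  have B : k * normc c ^+ 2 = e by rewrite cE /k divfK // sqrf_eq0 gt_eqF.
  move: h0c; rewrite /h B => h0c.
  have : 0 <= k * normc z0 ^+ 2 by rewrite mulr_ge0 ?sqr_ge0 ?(ltW k0).
  lra.
exfalso.
pose rho := (r - normc c) / 2; have rho0 : 0 < rho by rewrite divr_gt0 // subr_gt0.
(* Polarization of [h] at [c]: on the circle of radius [rho], h(y) - h(c) is Re(g - g(0)) + |f(y) -
   f(c)|^2 + k rho^2. At a maximum [c] of [h], Re g thus stays k rho^2 below Re g(0) on the whole
   circle, against the mean value property. *)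
pose g z := 2 * conjc (f c) * f (c + rho%:C%C * z) + 2 * k%:C%C * conjc c * (c + rho%:C%C * z).
have dg z : derivable g z 1.
  have I : is_derive z 1 (fun z => c + rho%:C%C * z) rho%:C%C.
    have := is_deriveD (is_derive_cst c z 1) (is_deriveZ rho%:C%C (is_derive_id z 1)).
    have -> : 0 + rho%:C%C *: 1 = rho%:C%C :> R[i] by rewrite add0r [_ *: _]mulr1.
    by [].
  have D1 := is_derive_compC I (entireP ef _).
  by have [] := is_deriveD (is_deriveZ (2 * conjc (f c)) D1) (is_deriveZ (2 * k%:C%C * conjc c) I).
have gc : continuous g.
  by move=> z; apply: differentiable_continuous; apply/derivable1_diffP.
have gm : rmean (fun t => Re (g (circ t))) = Re (g 0).
  apply: Re_mean_value; last exact: gc.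
  by move=> z _; exists ('D_1 g z); exact: derivableP.
have bd t : Re (g (circ t)) <= Re (g 0) - k * rho ^+ 2.
  set y := c + rho%:C%C * circ t.
  have yc : normc (y - c) = rho.
    by rewrite /y addrAC subrr add0r normcM normc_circ mulr1 normc_Creal gtr0_norm.
  have yr : normc y <= r.
    have := le_normcD c (rho%:C%C * circ t).
    rewrite -/y normcM normc_circ mulr1 normc_Creal gtr0_norm // /rho; lra.
  have hyc : h y <= h c by apply: Hc; rewrite inE.
  have -> : Re (g (circ t)) = Re (2 * conjc (f c) * f y + 2 * k%:C%C * conjc c * y) by [].
  rewrite /g mulr0 addr0.
  move: hyc yc => /[swap] /(congr1 (fun x => x ^+ 2)).
  rewrite /h !normc_sqr.
  case: (f y) => u v; case: (f c) => p q.
  case: (y) => a' b'; case: (c) => a b /=; move: (rho ^+ 2) => s <-.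
  have := sqr_ge0 (p - u); have := sqr_ge0 (q - v); rewrite !sqrrB; lra.
have gcirc : cont_circ g by move=> z _; exact: gc.
have [cR _] := @cont_circ_ReIm R g 0 (2 * pi) gcirc.
have := @rint_le R 0 (2 * pi) _ _ cR (@cont_on_cst R 0 (2 * pi) (Re (g 0) - k * rho ^+ 2)) (fun t _ => bd t).
rewrite rint_cst ?ler0pi2 // subr0 [X in _ <= X]mulrC -ler_pdivrMl ?pi2_gt0 // -/(rmean _) gm.
have : 0 < k * rho ^+ 2 by rewrite mulr_gt0 // exprn_gt0.
lra.
Qed.

Definition zeros_near f w := forall d : R, 0 < d ->
  exists z, 0 < normc (z - w) < d /\ f z = 0.

Lemma zero_of_zeros_near f w : {for w, continuous f} -> zeros_near f w -> f w = 0.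
Proof.
move=> cf ac; apply/eqP; rewrite -normc_eq0 eq_le normc_ge0 andbT.
apply/ler_addgt0Pr => e e0; rewrite add0r.
have [d d0 Hd] := (iffLR (continuousCP f w) cf) _ e0.
have [z [/andP[_ zd] fz]] := ac d d0.
by have := Hd z zd; rewrite fz sub0r normcN => /ltW.
Qed.

(** Dividing by z keeps every zero other than 0, so the quotient satisfies the same hypothesis. *)
Lemma zeros_near_factor n f : entire f -> zeros_near f 0 ->
  exists2 g, entire g & forall z, f z = z ^+ n * g z.
Proof.
elim: n f => [|n IH] f ef ac; first by exists f => // z; rewrite expr0 mul1r.
have f0 : f 0 = 0 by apply: zero_of_zeros_near ac; exact: entire_continuous.
have fE z : f z = z * dquot f 0 z.
  rewrite /dquot; case: eqVneq => [->|z0]; first by rewrite mul0r.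
  by rewrite f0 !subr0 mulrCA divff // mulr1.
have [|g eg gE] := IH _ (@dquot_entire f 0 ef).
  move=> d /ac[z [/andP[z0 zd] fz]]; exists z; rewrite z0 zd; split=> //.
  move: fz; rewrite fE => /eqP; rewrite mulf_eq0 => /orP[/eqP zE|/eqP //].
  by move: z0; rewrite zE subrr normc0 ltxx.
by exists g => // z; rewrite fE gE exprS mulrA.
Qed.

Lemma normcX z n : normc (z ^+ n) = normc z ^+ n.
Proof. by elim: n => [|n IH]; rewrite ?normc1 // !exprS normcM IH. Qed.

Lemma zeros_near_eq0 f : entire f -> zeros_near f 0 -> forall z, f z = 0.
Proof.
move=> ef ac z.
have f0 : f 0 = 0 by apply: zero_of_zeros_near ac; exact: entire_continuous.
have [->//|z0] := eqVneq z 0.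
have zp : 0 < normc z by rewrite normc_gt0.
(* Twice |z|, so that the maximum principle for f/z^n on the disc of radius [r] gives |f(z)| at most
   M/2^n. *)
pose r := 2 * normc z; have r0 : 0 < r by rewrite mulr_gt0.
have nfc : continuous (fun z => normc (f z)).
  move=> w; apply: (@continuous_comp _ _ _ f (@normc R)); last exact: normc_continuous.
  exact: entire_continuous.
have [||c _ Hc] := @compact_EVT_max _ R (fun z => normc (f z)) _ _ (@compact_disc R r).
- by exists (0 : R[i]); change (normc (0 : R[i]) <= r); rewrite normc0 ltW.
- exact: continuous_subspaceT.
set M := normc (f c) in Hc.
have M0 : 0 <= M by exact: normc_ge0.
have bd n : normc (f z) <= M / 2 ^+ n.
  have [g eg gE] := zeros_near_factor n ef ac.
  have rn : 0 < r ^+ n by rewrite exprn_gt0.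
  have gM : normc (g z) <= M / r ^+ n.
    apply: (@max_modulus g r) => // [w wr|]; last by rewrite /r mulr_natl mulr2n lerDl normc_ge0.
    rewrite ler_pdivlMr // mulrC -wr -normcX -normcM -gE; apply: Hc.
    by rewrite inE /= wr.
  rewrite gE normcM normcX.
  apply: le_trans (ler_wpM2l _ gM) _; first by rewrite exprn_ge0 // ltW.
  rewrite /r exprMn le_eqVlt; apply/orP; left; apply/eqP; field.
  by rewrite !expf_neq0 // gt_eqF.
apply/eqP; rewrite -normc_eq0 eq_le normc_ge0 andbT.
apply/ler_addgt0Pr => e e0; rewrite add0r.
apply: le_trans (bd (Num.bound (M / e))) _.
rewrite ler_pdivrMr ?exprn_gt0 // -ler_pdivrMl // mulrC ltW //.
exact: upper_nthrootP.
Qed.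

Lemma isolated_zeros f w : entire f -> (exists z, f z != 0) -> f w = 0 ->
  exists2 d : R, 0 < d & forall z, normc (z - w) < d -> f z = 0 -> z = w.
Proof.
move=> ef [z0 fz0] fw; apply: contrapT => H.
pose F z := f (w + z).
have eF : entire F.
  move=> z; have I : is_derive z 1 (fun z => w + z) 1.
    have := is_deriveD (is_derive_cst w z 1) (is_derive_id z 1).
    by rewrite add0r.
  by have [] := is_derive_compC I (entireP ef _).
have ac : zeros_near F 0.
  move=> d d0; apply: contrapT => K; apply: H; exists d => // z zd fz.
  apply: contrapT => zw; apply: K; exists (z - w).
  rewrite subr0 zd normc_gt0 subr_eq0 andbT; split; first exact/eqP.
  by rewrite /F addrC subrK.
move/eqP: fz0; apply; have := zeros_near_eq0 eF ac (z0 - w).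
by rewrite /F addrC subrK.
Qed.

End IsolatedZeros.

(** * Subharmonicity of the logarithm *)

Section LogMean.
Variable R : realType.
Notation mu := (@lebesgue_measure R).
Implicit Types (z w a b c : R[i]).

(** Half the logarithm of v^2 + e regularizes log v, including at v = 0 where the limit here is +oo.
    The sign and the constant [C] prepare Fatou's lemma, which wants nonnegative functions. *)
Lemma lne_limit (C v : R) (e_ : nat -> R) : 0 <= v ->
  (forall n, 0 < e_ n <= n.+1%:R^-1) ->
  (C - ln (v ^+ 2 + e_ n) / 2)%:E @[n --> \oo] --> (C%:E - lne v%:E)%E.
Proof.
move=> v0 He.
have e0 : e_ @ \oo --> (0 : R).
  apply: (@squeeze_cvgr _ _ _ _ (fun=> 0) (@harmonic R)).
  - by apply: nearW => n; have /andP[/ltW -> ->] := He n.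
  - exact: cvg_cst.
  - exact: cvg_harmonic.
move: v0; rewrite le_eqVlt => /predU1P[<-|vp].
  rewrite le0_lneNy // expr0n /=; apply/cvgeyPge => A.
  have p : 0 < expR (2 * (C - A)) :> R by exact: expR_gt0.
  have H := iffLR (cvgrPdist_lt _ _) e0 _ p.
  near=> n; rewrite lee_fin add0r.
  have /andP[en0 _] := He n.
  have : e_ n <= expR (2 * (C - A)).
    rewrite -[e_ n]gtr0_norm // -[e_ n]subr0 distrC; apply/ltW.
    by near: n; exact: H.
  by rewrite -ler_ln ?posrE ?expR_gt0 // expRK; lra.
rewrite lne_EFin // -EFinB; apply: cvg_EFin; first by apply: nearW.
have -> : ln v = ln (v ^+ 2 + 0) / 2.
  by rewrite addr0 lnXn // mulr2n; field.
apply: cvgB; first exact: cvg_cst.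
apply: cvgMl.
apply: (@cvg_comp _ _ _ (fun n => v ^+ 2 + e_ n) (@ln R) _ (nbhs (v ^+ 2 + 0))).
  by apply: cvgD => //; exact: cvg_cst.
by apply: continuous_ln; rewrite addr0 exprn_gt0.
Unshelve. all: by end_near. Qed.

(** On the closed unit disc 1 + c z stays in the right half-plane, where [clog] is holomorphic with
    real part log|1 + c z|; its value at 0 is log 1 = 0. *)
Lemma log_mean_lt1 c : normc c < 1 ->
  rmean (fun t => ln (normc (1 + c * circ t) ^+ 2)) = 0.
Proof.
move=> c1.
have pos z : normc z <= 1 -> 0 < Re (1 + c * z).
  move=> z1; have := Re_le_normc (c * z); rewrite normcM ler_norml => /andP[+ _].
  have : normc c * normc z <= normc c by rewrite ler_piMr ?normc_ge0.
  have -> : Re (1 + c * z) = 1 + Re (c * z) by case: (c * z).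
  lra.
pose F z := clog (1 + c * z).
have dF z : normc z <= 1 -> is_derive z 1 F ((1 + c * z)^-1 * c).
  move=> z1; have I : is_derive z 1 (fun z => 1 + c * z) c.
    have := is_deriveD (is_derive_cst (1 : R[i]) z 1) (is_deriveZ c (is_derive_id z 1)).
    have -> : 0 + c *: 1 = c :> R[i] by rewrite add0r [_ *: _]mulr1.
    by [].
  exact: (is_derive_compC I (is_derive_clog (pos z z1))).
have := @Re_mean_value R F.
have -> : Re (F 0) = 0.
  by rewrite /F mulr0 addr0 /= expr1n expr0n addr0 ln1 mul0r.
have -> : (fun t => Re (F (circ t))) = (fun t => 2^-1 * ln (normc (1 + c * circ t) ^+ 2)).
  by apply/funext => t; rewrite /F /clog normc_sqr mulrC.
rewrite /rmean => H.
have {}H : (2 * pi)^-1 * rint 0 (2 * pi) (fun t => 2^-1 * ln (normc (1 + c * circ t) ^+ 2)) = 0.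
  apply: H; last by have := dF 0; rewrite normc0 => /(_ ler01)/cont_derivable.
  by move=> z /andP[_ z1]; eexists; exact: dF.
rewrite rintZ in H; last first.
  move=> t _.
  have G : cont_circ (fun z => F z).
    by move=> z z1; have := dF z; rewrite z1 => /(_ (lexx _))/cont_derivable.
  have [cR _] := @cont_circ_ReIm R F t t G.
  have := cR t; rewrite lexx => /(_ isT).
  have -> : (fun t => Re (F (circ t))) = (fun t => ln (normc (1 + c * circ t) ^+ 2) / 2).
    by apply/funext => u; rewrite /F /clog normc_sqr.
  move=> cH.
  have -> : (fun t => ln (normc (1 + c * circ t) ^+ 2)) =
     (fun t => 2 * (ln (normc (1 + c * circ t) ^+ 2) / 2)).
    by apply/funext => u; field.
  by apply: continuousM; [exact: cst_continuous|exact: cH].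
by move: H => /eqP; rewrite mulrCA mulf_eq0 invr_eq0 pnatr_eq0 /= => /eqP.
Qed.

Lemma normc_sqrD z w :
  normc (z + w) ^+ 2 = normc z ^+ 2 + normc w ^+ 2 + 2 * Re (conjc z * w).
Proof. by rewrite !normc_sqr; case: z w => a b [c d] /=; ring. Qed.

Lemma log_sub_mean a b :
  (lne (normc a)%:E <= ((2 * pi)^-1)%:E *
    \int[mu]_(t in `[0%R, (2 * pi)%R]) lne (normc (a + circ t * b))%:E)%E.
Proof.
have [->|a0] := eqVneq a 0; first by rewrite normc0 le0_lneNy // leNye.
have ap : 0 < normc a by rewrite normc_gt0.
rewrite lne_EFin //.
(* With K > max(|a|^2, |b|^2), |a + b z|^2 + (K - |a|^2) (K - |b|^2) / K equals
   K |1 + c z|^2 on the unit circle, where |c| < 1; its logarithm has mean ln K.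
   Then K tends to max(|a|^2, |b|^2). *)
pose P := normc a ^+ 2; pose Q := normc b ^+ 2.
have P0 : 0 < P by rewrite exprn_gt0.
have Q0 : 0 <= Q by rewrite sqr_ge0.
pose K n : R := Num.max P Q + n.+1%:R^-1.
pose ep n := (K n - P) * (K n - Q) / K n.
pose N t := normc (a + circ t * b) ^+ 2.
have h0 n : 0 < n.+1%:R^-1 :> R by rewrite invr_gt0.
have KP n : P < K n by rewrite /K (@le_lt_trans _ _ (Num.max P Q)) ?le_max ?lexx // ltrDl.
have KQ n : Q < K n by rewrite /K (@le_lt_trans _ _ (Num.max P Q)) ?le_max ?lexx ?orbT // ltrDl.
have K0 n : 0 < K n by exact: lt_trans (KP n).
have ep0 n : 0 < ep n by rewrite divr_gt0 // mulr_gt0 // subr_gt0.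
have ep1 n : ep n <= n.+1%:R^-1.
  rewrite ler_pdivrMr //.
  have [PQ|QP] := leP P Q.
    have -> : K n - Q = n.+1%:R^-1 by rewrite /K max_r // addrC addKr.
    by rewrite mulrC ler_pM2l // gerBl ltW.
  have -> : K n - P = n.+1%:R^-1 by rewrite /K max_l ?ltW // addrC addKr.
  by rewrite ler_pM2l // gerBl.
(* 2 (P + Q) bounds |a + b z|^2 on the circle and 1 bounds [ep n], so all the functions [g n] below
   are nonnegative. *)
pose C := ln (2 * (P + Q) + 1) / 2.
have NE t : N t = P + Q + 2 * Re (conjc a * (circ t * b)).
  by rewrite /N normc_sqrD normcM normc_circ mul1r.
have N0 t : 0 <= N t by rewrite sqr_ge0.
have NB t : N t <= 2 * (P + Q).
  have := sqr_ge0 (normc a - normc b); rewrite sqrrB -/P -/Q NE.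
  have := Re_le_normc (conjc a * (circ t * b)).
  rewrite !normcM normcJ normc_circ mul1r ler_norml => /andP[_ +].
  rewrite -mulr_natl; lra.
have NK n t : N t + ep n = K n * normc (1 + conjc a * b / (K n)%:C%C * circ t) ^+ 2.
  have Kn0 : K n != 0 by rewrite gt_eqF.
  rewrite normc_sqrD NE !normcM normc_circ normcJ normcV normc_Creal (gtr0_norm (K0 n)).
  have -> : Re (conjc 1 * (conjc a * b / (K n)%:C%C * circ t)) = Re (conjc a * (circ t * b)) / K n.
    have -> : conjc 1 * (conjc a * b / (K n)%:C%C * circ t) = ((K n)^-1)%:C%C * (conjc a * (circ t * b)).
      have -> : ((K n)^-1)%:C%C = ((K n)%:C%C)^-1 by exact: fmorphV.
      have -> : conjc 1 = 1 :> R[i] by exact: rmorph1.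
      rewrite mul1r; move: (_^-1) (conjc a) (circ t) => p q r; ring.
    by case: (conjc a * (circ t * b)) => x y /=; ring.
  rewrite normc1 /ep !exprMn -/P -/Q exprVn; field.
  exact: Kn0.
have cN x y : cont_on x y N.
  move=> t _; have G : cont_circ (fun z => a + z * b).
    move=> z _; apply: continuousD; first exact: cst_continuous.
    by apply: continuousM; [|exact: cst_continuous].
  have [cR cI] := @cont_circ_ReIm R _ t t G.
  have tt : t <= t <= t by rewrite lexx.
  have -> : N = (fun t => Re (a + circ t * b) * Re (a + circ t * b) + Im (a + circ t * b) * Im (a + circ t * b)).
    by apply/funext => s; rewrite /N normc_sqr !expr2.
  apply: continuousD; apply: continuousM; [exact: cR tt|exact: cR tt|exact: cI tt|exact: cI tt].
have clnN n x y : cont_on x y (fun t => ln (N t + ep n)).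
  move=> t tI; apply: (@continuous_comp _ _ _ (fun t => N t + ep n) (@ln R)).
    by apply: continuousD; [exact: cN tI|exact: cst_continuous].
  by apply: continuous_ln; rewrite ltr_wpDl.
pose g n t := C - ln (N t + ep n) / 2.
have cg n x y : cont_on x y (g n).
  move=> t tI; apply: continuousB; first exact: cst_continuous.
  by apply: continuousM; [exact: clnN tI|exact: cst_continuous].
have g0 n t : 0 <= g n t.
  rewrite subr_ge0 ler_pM2r ?invr_gt0 // ler_ln ?posrE ?ltr_wpDl // ?mulr_ge0 ?addr_ge0 ?(ltW P0) //.
  by rewrite lerD // (le_trans (ep1 n)) // invf_le1 // ler1n.
have mean n : rint 0 (2 * pi) (fun t => ln (N t + ep n)) = 2 * pi * ln (K n).
  have c1 : normc (conjc a * b / (K n)%:C%C) < 1.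
    rewrite !normcM normcJ normcV normc_Creal (gtr0_norm (K0 n)) ltr_pdivrMr // mul1r.
    have KK : K n * K n = K n ^+ 2 by rewrite expr2.
    rewrite -(ltr_pXn2r (ltn0Sn 1)) ?nnegrE ?mulr_ge0 ?normc_ge0 ?(ltW (K0 n)) //.
    rewrite exprMn -/P -/Q expr2.
    apply: (@le_lt_trans _ _ (P * K n)); first by rewrite ler_pM2l // ltW.
    by rewrite ltr_pM2r.
  have := log_mean_lt1 c1; rewrite /rmean => /eqP.
  rewrite mulf_eq0 invr_eq0 gt_eqF ?pi2_gt0 //= => /eqP L0.
  have E t : ln (N t + ep n) = ln (K n) + ln (normc (1 + conjc a * b / (K n)%:C%C * circ t) ^+ 2).
    rewrite NK lnM // posrE //.
    have : 0 < N t + ep n by rewrite ltr_wpDl.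
    by rewrite NK pmulr_rgt0.
  have cX : cont_on 0 (2 * pi) (fun t => ln (normc (1 + conjc a * b / (K n)%:C%C * circ t) ^+ 2)).
    move=> t tI.
    have -> : (fun t => ln (normc (1 + conjc a * b / (K n)%:C%C * circ t) ^+ 2)) =
      (fun t => ln (N t + ep n) - ln (K n)) by apply/funext => s; rewrite E; ring.
    by apply: continuousB; [exact: clnN tI|exact: cst_continuous].
  rewrite (rintD_ext (@cont_on_cst R 0 (2 * pi) (ln (K n))) cX E) L0 addr0 rint_cst ?ler0pi2 //.
  by rewrite subr0 mulrC.
pose w t : \bar R := (C%:E - lne (normc (a + circ t * b))%:E)%E.
have gw t : (g n t)%:E @[n --> \oo] --> w t.
  by apply: lne_limit; [exact: normc_ge0|move=> n; rewrite ep0 ep1].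
pose D : set (measurableTypeR R) := [set` `[0%R, (2 * pi)%R]].
have mD : measurable D by exact: measurable_itv.
have ig n : mu.-integrable D (EFin \o g n) by apply: cont_on_integrable; exact: cg.
have mg n : measurable_fun D (EFin \o g n : measurableTypeR R -> \bar R) by have /integrableP[] := ig n.
have mw : measurable_fun D (w : measurableTypeR R -> \bar R).
  apply: (@emeasurable_fun_cvg _ _ _ D (fun n (t : measurableTypeR R) => (g n t)%:E)) => // t _; exact: gw.
have w0 t : D t -> (0 <= w t)%E.
  move=> _; have <- : limn (fun n => (g n t)%:E) = w t by apply/cvg_lim => //; exact: gw.
  apply: lime_ge; first by apply/cvg_ex; exists (w t); exact: gw.
  by apply: nearW => n; rewrite lee_fin.
(* Fatou's lemma gives one inequality, and it is the useful one: an upper bound for the integral of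
   C - log is a lower bound for that of log. Each approximating integral is explicit, and P < K n
   suffices to bound it. The finite bound also makes [w] integrable, so that [C] can be subtracted
   back. *)
have Iw : (\int[mu]_(t in D) w t <= (2 * pi * (C - ln P / 2))%:E)%E.
  have -> : (\int[mu]_(t in D) w t = \int[mu]_(t in D) limn_einf (fun n => (g n t)%:E))%E.
    by apply: eq_integral => t _; have [-> _] := cvg_limn_einf_sup (gw t).
  apply: le_trans (@fatou _ _ _ mu D mD (fun n t => (g n t)%:E) mg _) _.
    by move=> n t _; rewrite lee_fin.
  rewrite limn_einf_lim; apply: lime_le; first exact: is_cvg_einfs.
  apply: nearW => n; apply: (@le_trans _ _ (\int[mu]_(t in D) (g n t)%:E)%E).
    by apply: ereal_inf_lbound; exists n => /=.
  rewrite -[X in (X <= _)%E]fineK; last exact: (integrable_fin_num mD (ig n)).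
  rewrite lee_fin -[X in X <= _]/(rint 0 (2 * pi) (g n)).
  have cH : cont_on 0 (2 * pi) (fun t => ln (N t + ep n) / 2).
    by move=> t tI; apply: continuousM; [exact: clnN tI|exact: cst_continuous].
  rewrite (rintB (@cont_on_cst R 0 (2 * pi) C) cH) rint_cst ?ler0pi2 //.
  have -> : rint 0 (2 * pi) (fun t => ln (N t + ep n) / 2) = 2^-1 * (2 * pi * ln (K n)).
    rewrite -mean -(rintZ 2^-1 (clnN n 0 (2 * pi))).
    by apply: rint_ext => t _; rewrite mulrC.
  have LK : ln P <= ln (K n) by rewrite ler_ln ?posrE // ltW.
  have -> : C * (2 * pi - 0) - 2^-1 * (2 * pi * ln (K n)) = 2 * pi * (C - ln (K n) / 2) by field.
  by rewrite ler_pM2l ?pi2_gt0 // lerB // ler_pM2r.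
have iw : mu.-integrable D w.
  apply/integrableP; split=> //.
  have -> : (\int[mu]_(t in D) `|w t| = \int[mu]_(t in D) w t)%E.
    by apply: eq_integral => t; rewrite inE => /w0 wt0; rewrite gee0_abs.
  exact: le_lt_trans Iw (ltry _).
have iC : mu.-integrable D (EFin \o (fun=> C)).
  by apply: cont_on_integrable; exact: cont_on_cst.
have -> : (\int[mu]_(t in D) lne (normc (a + circ t * b))%:E =
    \int[mu]_(t in D) (C%:E - w t))%E.
  apply: eq_integral => t _; rewrite /w.
  by case: (lne _) => [r| |] //=; rewrite -!EFinB opprB addrC subrK.
rewrite (integralB mD iC iw).
have -> : (\int[mu]_(t in D) (C%:E) = (2 * pi * C)%:E)%E.
  rewrite -[LHS]fineK; last exact: (integrable_fin_num mD iC).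
  congr (_%:E); rewrite -[LHS]/(rint 0 (2 * pi) (fun=> C)) rint_cst ?ler0pi2 //.
  by rewrite subr0 mulrC.
have := integrable_fin_num mD iw; move: Iw.
case: (\int[mu]_(t in D) w t)%E => // r; rewrite lee_fin => rB _.
rewrite -EFinB -EFinM lee_fin -ler_pdivrMl ?invr_gt0 ?pi2_gt0 // invrK.
have -> : ln (normc a) = ln P / 2 by rewrite /P lnXn // mulr2n; field.
rewrite mulrBr in rB; lra.
Qed.

End LogMean.

(** * Pluripolarity of the degenerate fibres *)

Section Pluripolar.
Variable R : realType.
Implicit Types (z w : R[i]) (x y : R[i] * R[i]).

Definition log_dist z0 x : \bar R := lne (normc (x.1 - z0))%:E.

Lemma log_dist_lt z0 x (k : R) : (log_dist z0 x < k%:E)%E = (normc (x.1 - z0) < expR k).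
Proof.
rewrite /log_dist; have := normc_ge0 (x.1 - z0).
rewrite le_eqVlt => /predU1P[<-|v0]; first by rewrite le0_lneNy // ltNyr expR_gt0.
by rewrite lne_EFin // lte_fin -[in RHS](lnK v0) ltr_expR.
Qed.

(** Along a complex line x + l y the first coordinate minus [z0] is affine in l, which is the case
    treated by [log_sub_mean]. *)
Lemma log_dist_psh (B : set (R[i] * R[i])) z0 : plurisubharmonic B (log_dist z0).
Proof.
split.
- move=> x _; rewrite /log_dist; have := normc_ge0 (x.1 - z0).
  rewrite le_eqVlt => /predU1P[<-|v0]; first by rewrite le0_lneNy // ltNye.
  by rewrite lne_EFin // ltry.
- move=> x k _; rewrite log_dist_lt => xk; apply/nbhs_ballP.
  exists (expR k - normc (x.1 - z0))%:C%C; first by rewrite /= ltcR subr_gt0.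
  move=> y [+ _]; rewrite /ball /= normrC ltcR => xy; rewrite log_dist_lt.
  have -> : y.1 - z0 = (y.1 - x.1) + (x.1 - z0) by ring.
  apply: le_lt_trans (le_normcD _ _) _.
  by rewrite -ltrBrDr normcB.
move=> x y _; rewrite {1}/log_dist.
apply: le_trans (log_sub_mean (x.1 - z0) y.1) _.
rewrite le_eqVlt; apply/orP; left; apply/eqP; congr (_ * _)%E.
apply: eq_integral => t _; congr (lne (normc _)%:E) => /=.
by rewrite addrAC.
Qed.

Variables A B C : R[i] -> R[i].
Hypotheses (eA : entire A) (eB : entire B) (eC : entire C).

Definition qform (i : bool) x : R[i] :=
  if i then A x.1 + B x.1 * x.2 + C x.1 * x.2 ^+ 2
  else A x.1 * x.2 ^+ 2 + B x.1 * x.2 + C x.1.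

Lemma quadric_chart i x : quadric A B C (chart i x) <-> qform i x = 0.
Proof.
case: i; rewrite /quadric /qform /chart /=; last by [].
case: eqVneq => [->|v0] /=; first by rewrite mulr0 expr0n mulr0 !addr0.
have -> : A x.1 * x.2^-1 ^+ 2 + B x.1 * x.2^-1 + C x.1 =
  (A x.1 + B x.1 * x.2 + C x.1 * x.2 ^+ 2) / x.2 ^+ 2 by field.
split=> [/eqP|->]; last by rewrite mul0r.
by rewrite mulf_eq0 invr_eq0 sqrf_eq0 (negbTE v0) orbF => /eqP.
Qed.

Lemma differentiable_fstC x : differentiable (@fst R[i] R[i]) x.
Proof. by apply: linear_differentiable => y; exact: cvg_fst. Qed.

Lemma differentiable_sndC x : differentiable (@snd R[i] R[i]) x.
Proof. by apply: linear_differentiable => y; exact: cvg_snd. Qed.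

Lemma differentiable_entire_fst (f : R[i] -> R[i]) x : entire f -> differentiable (fun x => f x.1) x.
Proof.
move=> ef; apply: (@differentiable_comp _ _ _ _ fst f); first exact: differentiable_fstC.
by apply/derivable1_diffP; exact: ef.
Qed.

Lemma qform_differentiable i x : differentiable (qform i) x.
Proof.
have dA := differentiable_entire_fst x eA.
have dB := differentiable_entire_fst x eB.
have dC := differentiable_entire_fst x eC.
have d2 := differentiable_sndC x.
have d22 := differentiableM d2 d2.
case: i.
  have -> : qform true = (fun x => A x.1) + (fun x => B x.1) * snd + (fun x => C x.1) * (snd * snd).
    by apply/funext => y; rewrite /qform !fctE expr2.
  exact: differentiableD (differentiableD dA (differentiableM dB d2)) (differentiableM dC d22).
have -> : qform false = (fun x => A x.1) * (snd * snd) + (fun x => B x.1) * snd + (fun x => C x.1).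
  by apply/funext => y; rewrite /qform !fctE expr2.
exact: differentiableD (differentiableD (differentiableM dA d22) (differentiableM dB d2)) dC.
Qed.

Definition disc z := B z ^+ 2 - 4%:R * A z * C z.

Lemma disc_entire : entire disc.
Proof.
move=> z; have dA : derivable A z 1 by exact: eA.
have dB : derivable B z 1 by exact: eB.
have dC : derivable C z 1 by exact: eC.
have := derivableB (derivableM dB dB) (derivableM (@derivableZ _ _ _ A 4 z 1 dA) dC).
have -> // : B * B - (4 *: A) * C = disc.
by apply/funext => y; rewrite /disc !fctE expr2.
Qed.

Definition degenerate : set (CP1 R) := [set p | ~ quadric A B C p /\ disc p.1 = 0].

Lemma chart_surj (p : CP1 R) : exists i x, chart i x = p.
Proof.
case: p => z [w|]; first by exists false, (z, w).
by exists true, (z, 0); rewrite /chart /= eqxx.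
Qed.

Lemma chart_fst i x : (chart i x).1 = x.1.
Proof. by case: i. Qed.

Lemma degenerate_pluripolar : (exists z, disc z != 0) ->
  pluripolar (~` quadric A B C) degenerate.
Proof.
move=> disc0; split=> [p []|p [Dp]] //; have [i [x ip]] := chart_surj p.
rewrite -ip chart_fst => dx.
have [d d0 Hd] := isolated_zeros disc_entire disc0 dx.
have qx : qform i x != 0.
  by apply/eqP => q0; apply: Dp; rewrite -ip; apply/quadric_chart.
have qc : {for x, continuous (qform i)} by apply: differentiable_continuous; exact: qform_differentiable.
have : \forall y \near x, qform i y != 0.
  have FF : Filter (nbhs x) by exact: nbhs_filter.
  have n0 : 0 < normc (qform i x) by rewrite normc_gt0.
  have := iffLR (cvgCP FF (qform i) (qform i x)) qc _ n0.
  apply: filterS => y; apply: contraTneq => ->.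
  by rewrite sub0r normcN ltxx.
case/nbhs_ballP => e /= /gtC0P[e' e'0 ->] He.
(* [d] isolates the zero of the discriminant and [e'] keeps the ball off D. Points with first
   coordinate x.1 + r/2 show that the logarithm is not identically -oo. *)
pose r := Num.min d e'; have r0 : 0 < r by rewrite lt_min d0.
exists i, x, r%:C%C, (log_dist x.1).
have sub y : ball x r%:C%C y -> normc (y.1 - x.1) < d /\ ball x e'%:C%C y.
  move=> [] ; rewrite /ball /= !normrC !ltcR !lt_min => /andP[h1 h2] /andP[_ h4].
  by rewrite normcB; split=> //; split; rewrite /ball /= normrC ltcR.
split=> //.
- by rewrite ltcR.
- by move=> y /sub[_ /He qy] /quadric_chart /eqP; apply/negP.
- exact: log_dist_psh.
split.
  have r2 : 0 < r / 2 by rewrite divr_gt0.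
  exists (x.1 + (r / 2)%:C%C, x.2).
    split; rewrite /ball /= normrC ltcR ?subrr ?normc0 //.
    rewrite opprD addrA subrr sub0r normcN normc_Creal gtr0_norm //.
    by rewrite ltr_pdivrMr // ltr_pMr // ltr1n.
  rewrite /log_dist [X in normc X](_ : _ = (r / 2)%:C%C); last first.
    by rewrite [LHS]addrAC subrr add0r.
  by rewrite normc_Creal gtr0_norm // lne_EFin.
move=> y /sub[yd _] [_]; rewrite chart_fst => dy.
by rewrite /log_dist (Hd _ yd dy) subrr normc0 le0_lneNy.
Qed.

End Pluripolar.

(** * The Riccati flow *)

Section Connected.
Variable R : realType.

Lemma connectedC : connected [set: R[i]].
Proof.
pose line (w : R[i]) : set R[i] := (fun s : R => s%:C%C * w) @` [set: R].
have -> : [set: R[i]] = \bigcup_(w in [set: R[i]]) line w.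
  apply/esym/seteqP; split=> // w _; exists w => //.
  by exists 1 => //; rewrite mul1r.
apply: bigcup_connected; first by exists 0 => w _; exists 0 => //; rewrite mul0r.
move=> w _; apply: connected_continuous_connected.
  by apply/connected_intervalP => x y z /=.
apply: continuous_subspaceT => s.
have FF : Filter (nbhs s) by exact: nbhs_filter.
apply/(cvgCP FF (fun s : R => s%:C%C * w)) => e e0; apply/nearRP.
exists (e / (normc w + 1)) => [|t ts]; first by rewrite divr_gt0 // ltr_wpDl // normc_ge0.
rewrite -mulrBl -rmorphB normcM normc_Creal.
move: ts; rewrite ltr_pdivlMr ?ltr_wpDl ?normc_ge0 // => /(le_lt_trans _); apply.
by rewrite ler_wpM2l // lerDl.
Qed.

Lemma is_derive0_connected (V : set R[i]) (f : R[i] -> R[i]) : open V -> connected V ->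
  (forall t, V t -> is_derive t 1 f 0) -> forall s t, V s -> V t -> f t = f s.
Proof.
move=> oV cV df s t Vs Vt.
(* Local constancy makes any condition on the value of [f] open; it is applied to f x = f s and to
   its negation. *)
have op (P : R[i] -> Prop) : (forall x y, f x = f y -> P x -> P y) -> open [set x | V x /\ P x].
  move=> PE; rewrite openE => x [Vx Px].
  have /nearCP[d d0 Hd] : nbhs x V by exact: open_nbhs_nbhs.
  apply/nearCP; exists d => // y yd; split; first exact: Hd.
  apply: PE Px; apply/esym; apply: is_derive0_ball yd => w wd; apply: df; exact: Hd.
have E : [set x | V x /\ f x = f s] = V.
  apply: cV.
  - by exists s.
  - exists [set x | V x /\ f x = f s]; first by apply: op => x y ->.
    by apply/seteqP; split=> x [] //.
  - exists (~` [set x | V x /\ f x <> f s]).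
      by apply: open_closedC; apply: op => x y ->.
    by apply/seteqP; split=> x [Vx H]; split=> //; [case|apply: contrapT => K; apply: H].
by have : V t := Vt; rewrite -E => -[].
Qed.

End Connected.

(** * Projective curves and the exponential of N *)

Section PairDerivative.
Variable R : realType.
Implicit Types (t l m k : R[i]).

Lemma is_derive_pairC (f g : R[i] -> R[i]) t l m :
  is_derive t 1 f l -> is_derive t 1 g m -> is_derive t 1 (fun s => (f s, g s)) (l, m).
Proof.
move=> /is_derive_is_diffC F /is_derive_is_diffC G.
have [D E] := is_diff_pair F G.
apply: DeriveDef; first by apply/derivable1_diffP.
by rewrite deriveE // E /= !mul1r.
Qed.

Lemma is_derive_fstsnd (x : R[i] -> R[i] * R[i]) t (l : R[i] * R[i]) : is_derive t 1 x l ->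
  is_derive t 1 (fun s => (x s).1) l.1 /\ is_derive t 1 (fun s => (x s).2) l.2.
Proof.
case=> /derivable1_diffP D E.
have E' : 'd x t 1 = l by rewrite -deriveE.
have D1 := differentiable_comp D (differentiable_fstC (x t)).
have D2 := differentiable_comp D (differentiable_sndC (x t)).
split; apply: DeriveDef.
- exact/derivable1_diffP/D1.
- rewrite (deriveE _ D1) (diff_comp D (differentiable_fstC _)) /= diff_lin ?E' // => y.
  exact: cvg_fst.
- exact/derivable1_diffP/D2.
- rewrite (deriveE _ D2) (diff_comp D (differentiable_sndC _)) /= diff_lin ?E' // => y.
  exact: cvg_snd.
Qed.

Lemma is_deriveMC (f g : R[i] -> R[i]) t l m : is_derive t 1 f l -> is_derive t 1 g m ->
  is_derive t 1 (fun s => f s * g s) (f t * m + g t * l).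
Proof. by move=> F G; exact: (is_deriveM F G). Qed.

Lemma is_deriveDC (f g : R[i] -> R[i]) t l m : is_derive t 1 f l -> is_derive t 1 g m ->
  is_derive t 1 (fun s => f s + g s) (l + m).
Proof. by move=> F G; exact: (is_deriveD F G). Qed.

Lemma is_deriveBC (f g : R[i] -> R[i]) t l m : is_derive t 1 f l -> is_derive t 1 g m ->
  is_derive t 1 (fun s => f s - g s) (l - m).
Proof. by move=> F G; exact: (is_deriveB F G). Qed.

Lemma is_deriveZC (k : R[i]) (f : R[i] -> R[i]) t l : is_derive t 1 f l ->
  is_derive t 1 (fun s => k * f s) (k * l).
Proof. by move=> F; exact: (is_deriveZ k F). Qed.

Lemma is_derive_quotC (f g : R[i] -> R[i]) t l m : g t != 0 ->
  is_derive t 1 f l -> is_derive t 1 g m ->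
  is_derive t 1 (fun s => f s / g s) ((l * g t - f t * m) / g t ^+ 2).
Proof.
move=> g0 F [G Ge].
have V : is_derive t 1 (fun s => (g s)^-1) (- g t ^- 2 * m).
  by apply: DeriveDef; [exact: derivableV|rewrite deriveV // Ge].
have := is_deriveMC F V.
have -> // : f t * (- g t ^- 2 * m) + (g t)^-1 * l = (l * g t - f t * m) / g t ^+ 2.
by field.
Qed.

(** The point [x : y]; the default value [Inf] at (0, 0) is harmless, since lifts are shown not to
    vanish. *)
Definition proj (x y : R[i]) : P1 R := if y == 0 then Inf else Fin (x / y).

Lemma proj_eq x y x' y' : x' * y = x * y' -> (x != 0) || (y != 0) -> (x' != 0) || (y' != 0) ->
  proj x y = proj x' y'.
Proof.
move=> E; rewrite /proj; have [y0|y0] := eqVneq y 0; have [y'0|y'0] := eqVneq y' 0 => //=.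
- rewrite orbF => x0 _; move/eqP: E; rewrite y0 mulr0 eq_sym.
  by rewrite mulf_eq0 (negbTE x0) (negbTE y'0).
- rewrite orbF => _ x'0; move/eqP: E; rewrite y'0 mulr0.
  by rewrite mulf_eq0 (negbTE x'0) (negbTE y0).
- by move=> _ _; congr Fin; apply/eqP; rewrite eqr_div // E.
Qed.

(** Near each time one of the two quotients is a chart coordinate of the projected curve. The curve
    [x] is given explicitly so that the quotient rule applies to it. *)
Lemma proj_chart (z : R[i]) (f g : R[i] -> R[i]) t l m :
  is_derive t 1 f l -> is_derive t 1 g m -> (f t != 0) || (g t != 0) ->
  exists (i : bool) (x : R[i] -> R[i] * R[i]),
    (\forall s \near t, (z, proj (f s) (g s)) = chart i (x s)) /\
    if i then x = (fun s => (z, g s / f s)) /\ f t != 0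
    else x = (fun s => (z, f s / g s)) /\ g t != 0.
Proof.
move=> F G.
have nz (h : R[i] -> R[i]) k : is_derive t 1 h k -> h t != 0 -> \forall s \near t, h s != 0.
  move=> /cont_derivable hc h0; have FF : Filter (nbhs t) by exact: nbhs_filter.
  have n0 : 0 < normc (h t) by rewrite normc_gt0.
  have := iffLR (cvgCP FF h (h t)) hc _ n0.
  by apply: filterS => y; apply: contraTneq => ->; rewrite sub0r normcN ltxx.
have [g0 _|/negPn/eqP gt0] := boolP (g t != 0).
  exists false, (fun s => (z, f s / g s)); split=> //.
  by apply: filterS (nz _ _ G g0) => s gs; rewrite /chart /proj /= (negbTE gs).
rewrite orbF => f0.
exists true, (fun s => (z, g s / f s)); split=> //.
apply: filterS (nz _ _ F f0) => s fs; rewrite /chart /proj /=.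
by rewrite mulf_eq0 invr_eq0 (negbTE fs) orbF invf_div.
Qed.

(* exp(t N) = C(t) + S(t) N for any matrix N such that N^2 = k. *)
Lemma exp_pair (k : R[i]) : exists d (C S : R[i] -> R[i]),
  [/\ d ^+ 2 = k, forall t, is_derive t 1 C (k * S t), forall t, is_derive t 1 S (C t),
      C 0 = 1 /\ S 0 = 0 & (forall t, C t ^+ 2 - k * S t ^+ 2 = 1) /\
      (d != 0 -> forall t, C t = (cexp (d * t) + cexp (- (d * t))) / 2 /\
                           S t = (cexp (d * t) - cexp (- (d * t))) / (2 * d))].
Proof.
have [->|k0] := eqVneq k 0.
  exists 0, (fun=> 1), id; split=> //.
  - by rewrite expr0n.
  - by move=> t; rewrite mul0r; exact: is_derive_cst.
  - by move=> t; exact: is_derive_id.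
  - by split=> [t|]; rewrite ?eqxx // mul0r subr0 expr1n.
pose d := sqrtc k; have dk : d ^+ 2 = k by exact: sqr_sqrtc.
have d0 : d != 0 by apply: contra_neq k0 => d0; rewrite -dk d0 expr0n.
pose E t := cexp (d * t); pose E' t := cexp (- (d * t)).
have dE t : is_derive t 1 E (d * E t).
  have := is_derive_compC (is_deriveZC d (is_derive_id t 1)) (is_derive_cexp _).
  by rewrite mulr1 mulrC.
have dE' t : is_derive t 1 E' (- d * E' t).
  have -> : E' = (fun t => cexp (- d * t)) by apply/funext => s; rewrite /E' mulNr.
  have := is_derive_compC (is_deriveZC (- d) (is_derive_id t 1)) (is_derive_cexp _).
  by rewrite mulr1 mulrC.
have EE t : E t * E' t = 1 by rewrite /E /E' -cexpD subrr cexp0.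
exists d, (fun t => 2^-1 * (E t + E' t)), (fun t => (2 * d)^-1 * (E t - E' t)); split=> //.
- move=> t; have := is_deriveZC 2^-1 (is_deriveDC (dE t) (dE' t)).
  have -> // : 2^-1 * (d * E t + - d * E' t) = k * ((2 * d)^-1 * (E t - E' t)).
  by rewrite -dk; field.
- move=> t; have := is_deriveZC (2 * d)^-1 (is_deriveBC (dE t) (dE' t)).
  have -> // : (2 * d)^-1 * (d * E t - - d * E' t) = 2^-1 * (E t + E' t).
  by field.
- by rewrite /E /E' mulr0 oppr0 cexp0 subrr mulr0; split=> //; field.
split=> [t|_ t]; last by rewrite /E /E'; split; exact: mulrC.
rewrite -dk.
have -> : (2^-1 * (E t + E' t)) ^+ 2 - d ^+ 2 * ((2 * d)^-1 * (E t - E' t)) ^+ 2 = E t * E' t.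
  by field.
exact: EE.
Qed.

End PairDerivative.

(** * Orbits of the Riccati field in one fibre *)

Section Flow.
Variable R : realType.
Variables A B C : R[i] -> R[i].

(** Since dv = - dw / w^2, the field reads - (A + B v + C v^2) d/dv near infinity: degree two is
    exactly what extends to P^1 without a pole. *)
Definition riccati : vfield R :=
  fun i x => (0, if i then - qform A B C true x else qform A B C false x).

Let M := ~` quadric A B C.

Section Orbit.
Implicit Types (t : R[i]).
Variables (z : R[i]) (x0 y0 : R[i]).
Variables a b c k : R[i].
Hypotheses (aE : A z = a) (bE : B z = b) (cE : C z = c) (kE : k = b ^+ 2 / 4 - a * c).
Hypothesis Q0 : a * x0 ^+ 2 + b * x0 * y0 + c * y0 ^+ 2 != 0.
Variables (ch sh : R[i] -> R[i]).
Hypotheses (dch : forall t, is_derive t 1 ch (k * sh t)).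
Hypotheses (dsh : forall t, is_derive t 1 sh (ch t)).
Hypotheses (ch0 : ch 0 = 1) (sh0 : sh 0 = 0).
Hypothesis (det1 : forall t, ch t ^+ 2 - k * sh t ^+ 2 = 1).

(** With [Ny], the traceless matrix N of square [k]. If (x, y)' = N (x, y), then w = x/y satisfies
    w' = a w^2 + b w + c. *)
Let Nx x y := b / 2 * x + c * y.
Let Ny x y := - a * x - b / 2 * y.
Definition orbX t := ch t * x0 + sh t * Nx x0 y0.
Definition orbY t := ch t * y0 + sh t * Ny x0 y0.

Lemma is_derive_orbX t : is_derive t 1 orbX (Nx (orbX t) (orbY t)).
Proof.
have := is_deriveDC (is_deriveZC x0 (dch t)) (is_deriveZC (Nx x0 y0) (dsh t)).
have -> : (fun s => x0 * ch s + Nx x0 y0 * sh s) = orbX.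
  by apply/funext => s; rewrite /orbX (mulrC (ch s)) (mulrC (sh s)).
have -> // : x0 * (k * sh t) + Nx x0 y0 * ch t = Nx (orbX t) (orbY t).
by rewrite /orbX /orbY /Nx /Ny kE; field.
Qed.

Lemma is_derive_orbY t : is_derive t 1 orbY (Ny (orbX t) (orbY t)).
Proof.
have := is_deriveDC (is_deriveZC y0 (dch t)) (is_deriveZC (Ny x0 y0) (dsh t)).
have -> : (fun s => y0 * ch s + Ny x0 y0 * sh s) = orbY.
  by apply/funext => s; rewrite /orbY (mulrC (ch s)) (mulrC (sh s)).
have -> // : y0 * (k * sh t) + Ny x0 y0 * ch t = Ny (orbX t) (orbY t).
by rewrite /orbX /orbY /Nx /Ny kE; field.
Qed.

(** The form is det(N v, v), and exp(t N) commutes with N and has determinant ch^2 - k sh^2 = 1. *)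
Lemma orb_form t : a * orbX t ^+ 2 + b * orbX t * orbY t + c * orbY t ^+ 2 =
  a * x0 ^+ 2 + b * x0 * y0 + c * y0 ^+ 2.
Proof.
have -> : a * orbX t ^+ 2 + b * orbX t * orbY t + c * orbY t ^+ 2 =
  (ch t ^+ 2 - k * sh t ^+ 2) * (a * x0 ^+ 2 + b * x0 * y0 + c * y0 ^+ 2).
  by rewrite /orbX /orbY /Nx /Ny kE; field.
by rewrite det1 mul1r.
Qed.

Lemma orb_neq0 t : (orbX t != 0) || (orbY t != 0).
Proof.
apply: contraT; rewrite negb_or !negbK => /andP[/eqP x /eqP y].
by have := Q0; rewrite -(orb_form t) x y expr0n /= !mulr0 !addr0 eqxx.
Qed.

Definition orb t : CP1 R := (z, proj (orbX t) (orbY t)).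

Lemma quadric_proj x y : (x != 0) || (y != 0) ->
  quadric A B C (z, proj x y) <-> a * x ^+ 2 + b * x * y + c * y ^+ 2 = 0.
Proof.
rewrite /quadric /proj /=; have [->|yn] := eqVneq y 0; rewrite /= ?aE ?bE ?cE.
  rewrite orbF expr0n /= !mulr0 !addr0 => xn.
  split=> [->|/eqP]; first by rewrite mul0r.
  by rewrite mulf_eq0 sqrf_eq0 (negbTE xn) orbF => /eqP.
move=> _; have -> : a * (x / y) ^+ 2 + b * (x / y) + c = (a * x ^+ 2 + b * x * y + c * y ^+ 2) / y ^+ 2.
  by field.
split=> [/eqP|->]; last by rewrite mul0r.
by rewrite mulf_eq0 invr_eq0 sqrf_eq0 (negbTE yn) orbF => /eqP.
Qed.

Lemma orb_solution : solution M riccati setT orb.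
Proof.
move=> t _; split.
  by move/(quadric_proj (orb_neq0 t)); rewrite orb_form; apply/eqP.
have dX := is_derive_orbX t; have dY := is_derive_orbY t.
have [i [x [near_x]]] := proj_chart z dX dY (orb_neq0 t).
case: i near_x => near_x [xE n0].
  exists true, x; split; first exact: near_x.
  rewrite xE; have := is_derive_pairC (is_derive_cst z t 1) (is_derive_quotC n0 dY dX).
  rewrite /riccati /qform /= aE bE cE.
  have -> // : (Ny (orbX t) (orbY t) * orbX t - orbY t * Nx (orbX t) (orbY t)) / orbX t ^+ 2 =
    - (a + b * (orbY t / orbX t) + c * (orbY t / orbX t) ^+ 2).
  by rewrite /Nx /Ny; field.
exists false, x; split; first exact: near_x.
rewrite xE; have := is_derive_pairC (is_derive_cst z t 1) (is_derive_quotC n0 dX dY).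
rewrite /riccati /qform /= aE bE cE.
have -> // : (Nx (orbX t) (orbY t) * orbY t - orbX t * Ny (orbX t) (orbY t)) / orbY t ^+ 2 =
  a * (orbX t / orbY t) ^+ 2 + b * (orbX t / orbY t) + c.
by rewrite /Nx /Ny; field.
Qed.

Lemma orb_0 : orb 0 = (z, proj x0 y0).
Proof. by rewrite /orb /orbX /orbY ch0 sh0 !mul1r !mul0r !addr0. Qed.

Let rx (q : P1 R) : R[i] := if q is Fin w then w else 1.
Let ry (q : P1 R) : R[i] := if q is Fin w then 1 else 0.

(* Along a solution q, J is constant: det(q, orb)^2 and the form defining D are
   multiplied by the same factor, and J, their quotient, has degree 0 in q. *)
Let J t (q : P1 R) := (ry q * orbX t - rx q * orbY t) ^+ 2 /
  (a * rx q ^+ 2 + b * rx q * ry q + c * ry q ^+ 2).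

Let J_hom t x y (l : R[i]) : l != 0 -> 
  (l * y * orbX t - l * x * orbY t) ^+ 2 /
  (a * (l * x) ^+ 2 + b * (l * x) * (l * y) + c * (l * y) ^+ 2) =
  (y * orbX t - x * orbY t) ^+ 2 / (a * x ^+ 2 + b * x * y + c * y ^+ 2).
Proof.
move=> l0.
have -> : (l * y * orbX t - l * x * orbY t) ^+ 2 = l ^+ 2 * (y * orbX t - x * orbY t) ^+ 2 by ring.
have -> : a * (l * x) ^+ 2 + b * (l * x) * (l * y) + c * (l * y) ^+ 2 =
  l ^+ 2 * (a * x ^+ 2 + b * x * y + c * y ^+ 2) by ring.
by rewrite -mulf_div divff ?mul1r // sqrf_eq0.
Qed.

Let J_chart t (i : bool) (x : R[i] * R[i]) : J t (chart i x).2 =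
  if i then (x.2 * orbX t - orbY t) ^+ 2 / (a + b * x.2 + c * x.2 ^+ 2)
  else (orbX t - x.2 * orbY t) ^+ 2 / (a * x.2 ^+ 2 + b * x.2 + c).
Proof.
rewrite /J /chart; case: i => /=; last by rewrite !mul1r expr1n !mulr1.
case: eqVneq => [->|v0] /=; first by rewrite !(mul0r, mulr0, mul1r, mulr1, expr1n, expr0n, addr0).
rewrite -(J_hom t x.2^-1 1 v0); congr (_ ^+ 2 / _); field; done.
Qed.

(** The z-component has derivative 0, so [psi] stays in its fibre; there the denominator of [J] is
    nonzero because a solution in [M] avoids D. [J] starts at 0, hence vanishes on the connected
    [V], and its vanishing says that the two points of P^1 coincide. *)
Lemma solution_unique V psi : solution_through M riccati (z, proj x0 y0) V psi ->
  forall t, V t -> psi t = orb t.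
Proof.
move=> [oV cV V0 sol psi0].
have dz t : V t -> is_derive t 1 (fun s => (psi s).1) 0.
  move=> /sol[_ [i [x [near_x dx]]]].
  have [dx1 _] := is_derive_fstsnd dx.
  apply: near_eq_is_derive dx1; apply: filterS near_x => s ->.
  by rewrite chart_fst.
have zc t : V t -> (psi t).1 = z.
  by move=> Vt; rewrite (is_derive0_connected oV cV dz V0 Vt) psi0.
have qf_neq0 t (i : bool) x : V t -> psi t = chart i x ->
    (if i then a + b * x.2 + c * x.2 ^+ 2 else a * x.2 ^+ 2 + b * x.2 + c) != 0 /\ x.1 = z.
  move=> Vt pE; have xz : x.1 = z by rewrite -(chart_fst i) -pE zc.
  split=> //; have [Mt _] := sol t Vt; apply/eqP => q0; apply: Mt.
  rewrite pE; apply/quadric_chart; rewrite /qform xz aE bE cE.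
  by case: (i) q0.
have dJ t : V t -> is_derive t 1 (fun s => J s (psi s).2) 0.
  move=> Vt; have [_ [i [x [near_x dx]]]] := sol t Vt.
  have pE : psi t = chart i (x t) by exact: (nbhs_singleton near_x).
  have [q0 xz] := qf_neq0 t i (x t) Vt pE.
  have [_ dv] := is_derive_fstsnd dx.
  have dX := is_derive_orbX t; have dY := is_derive_orbY t.
  case: i near_x dx pE q0 dv => near_x dx pE q0 dv; rewrite /riccati /qform /= xz aE bE cE in dv.
    have dn := is_deriveBC (is_deriveMC dv dX) dY.
    have dq := is_deriveDC (is_deriveDC (is_derive_cst a t 1) (is_deriveZC b dv))
      (is_deriveZC c (is_deriveMC dv dv)).
    have q0' : a + b * (x t).2 + c * ((x t).2 * (x t).2) != 0 by rewrite -expr2.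
    have := @is_derive_quotC R _ (fun s => cst a s + b * (x s).2 + c * ((x s).2 * (x s).2))
      t _ _ q0' (is_deriveMC dn dn) dq.
    set l := (X in is_derive _ _ _ X -> _).
    have -> : l = 0.
      rewrite /l; apply/eqP; rewrite mulf_eq0; apply/orP; left; apply/eqP.
      by rewrite /Nx /Ny /cst /=; move: (orbX t) (orbY t) (x t).2 => X Y v; field.
    move=> dl; apply: near_eq_is_derive dl; apply: filterS near_x => s ->.
    by rewrite J_chart !expr2.
  have dn := is_deriveBC dX (is_deriveMC dv dY).
  have dq := is_deriveDC (is_deriveDC (is_deriveZC a (is_deriveMC dv dv)) (is_deriveZC b dv))
    (is_derive_cst c t 1).
  have q0' : a * ((x t).2 * (x t).2) + b * (x t).2 + c != 0 by rewrite -expr2.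
  have := @is_derive_quotC R _ (fun s => a * ((x s).2 * (x s).2) + b * (x s).2 + cst c s)
    t _ _ q0' (is_deriveMC dn dn) dq.
  set l := (X in is_derive _ _ _ X -> _).
  have -> : l = 0.
    rewrite /l; apply/eqP; rewrite mulf_eq0; apply/orP; left; apply/eqP.
    by rewrite /Nx /Ny /cst /=; move: (orbX t) (orbY t) (x t).2 => X Y v; field.
  move=> dl; apply: near_eq_is_derive dl; apply: filterS near_x => s ->.
  by rewrite J_chart !expr2.
have J0 t : V t -> J t (psi t).2 = 0.
  move=> Vt; rewrite (is_derive0_connected oV cV dJ V0 Vt) psi0 /J /=.
  rewrite /orbX /orbY ch0 sh0 !mul1r !mul0r !addr0 /proj.
  case: eqVneq => [->|yn] /=; first by rewrite mul0r mulr0 subrr expr0n mul0r.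
  by rewrite mul1r divfK // subrr expr0n mul0r.
move=> t Vt; have := J0 t Vt; have [i [x xE]] := chart_surj (psi t).
have [q0 xz] := qf_neq0 t i x Vt (esym xE); rewrite -xE J_chart.
move: q0; rewrite /orb /chart; case: i {xE} => q0 /eqP;
  rewrite mulf_eq0 invr_eq0 (negbTE q0) orbF sqrf_eq0 subr_eq0 => /eqP E; rewrite xz; congr pair.
  have -> : (if x.2 == 0 then Inf else Fin x.2^-1) = proj 1 x.2 by rewrite /proj div1r.
  by apply: proj_eq; rewrite ?oner_eq0 ?orb_neq0 // mul1r mulrC.
have -> : Fin x.2 = proj x.2 1 by rewrite /proj oner_eq0 divr1.
by apply: proj_eq; rewrite ?oner_eq0 ?orb_neq0 ?orbT // mulr1.
Qed.

Lemma orb_maximal : maximal_solution M riccati (z, proj x0 y0) setT orb.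
Proof.
split; last by move=> V psi sol; split=> // t Vt; exact: solution_unique sol t Vt.
by split=> //; [exact: openT|exact: connectedC|exact: orb_solution|exact: orb_0].
Qed.

Lemma maximal_orb U phi : maximal_solution M riccati (z, proj x0 y0) U phi ->
  U = setT /\ phi = orb.
Proof.
move=> [_ mx]; have [TU E] := mx _ _ (proj1 orb_maximal).
split; first by apply/seteqP; split=> // t _; exact: TU.
by apply/funext => t; rewrite E.
Qed.

Lemma trajectory_orb : trajectory M riccati (z, proj x0 y0) = range orb.
Proof.
apply/seteqP; split=> q.
  by move=> [U [phi [/maximal_orb[-> ->] [t _ <-]]]]; exists t.
by move=> [t _ <-]; exists setT, orb; split; [exact: orb_maximal|exists t].
Qed.

End Orbit.
End Flow.

(** * The global Riccati field and its C^* orbits *)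

Section RiccatiField.
Variable R : realType.

Definition repX (q : P1 R) : R[i] := if q is Fin w then w else 1.
Definition repY (q : P1 R) : R[i] := if q is Fin w then 1 else 0.

Lemma rep_neq0 q : (repX q != 0) || (repY q != 0).
Proof. by case: q => [w|] /=; rewrite oner_eq0 ?orbT. Qed.

Lemma proj_rep q : proj (repX q) (repY q) = q.
Proof. by case: q => [w|]; rewrite /proj /= ?eqxx // oner_eq0 divr1. Qed.

(* The inverse of s |-> [s P + Q]. *)
Definition pencil (px py qx qy : R[i]) (q : P1 R) : R[i] :=
  - (qx * repY q - qy * repX q) / (px * repY q - py * repX q).

(** Cramer's rule: pairing s P + Q with Q and with P gives s det(P, Q) and det(P, Q), whose quotient
    does not depend on the representative of the projective point. *)
Lemma pencilE px py qx qy s : px * qy - py * qx != 0 -> s != 0 ->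
  (s * px + qx != 0) || (s * py + qy != 0) /\
  pencil px py qx qy (proj (s * px + qx) (s * py + qy)) = s.
Proof.
move=> D0 s0; set X := s * px + qx; set Y := s * py + qy.
have n0 : (X != 0) || (Y != 0).
  apply: contraNT D0; rewrite negb_or !negbK => /andP[/eqP X0 /eqP Y0].
  have -> : px * qy - py * qx = px * Y - py * X by rewrite /X /Y; ring.
  by rewrite X0 Y0 !mulr0 subrr.
split=> //.
have E1 : - (qx * Y - qy * X) = s * (px * qy - py * qx) by rewrite /X /Y; ring.
have E2 : px * Y - py * X = px * qy - py * qx by rewrite /X /Y; ring.
suff -> : pencil px py qx qy (proj X Y) = - (qx * Y - qy * X) / (px * Y - py * X).
  by rewrite E1 E2 mulfK.
rewrite /pencil /proj; case: (eqVneq Y 0) n0 => [->|Y0] /= n0.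
  rewrite orbF in n0.
  have -> : - (qx * 0 - qy * X) = - (qx * 0 - qy * 1) * X by ring.
  have -> : px * 0 - py * X = (px * 0 - py * 1) * X by ring.
  by rewrite -mulf_div (divff n0) [RHS]mulr1.
have -> : - (qx * Y - qy * X) = - (qx * 1 - qy * (X / Y)) * Y by field.
have -> : px * Y - py * X = (px * 1 - py * (X / Y)) * Y by field.
by rewrite -mulf_div (divff Y0) [RHS]mulr1.
Qed.

Variables A B C : R[i] -> R[i].
Let M := ~` quadric A B C.
Let X := riccati A B C.

Lemma orbit_data (p : CP1 R) : M p -> exists phi,
  [/\ maximal_solution M X p setT phi,
      (forall U psi, maximal_solution M X p U psi -> U = setT /\ psi = phi),
      trajectory M X p = range phi, (forall t, (phi t).1 = p.1)
    & disc A B C p.1 != 0 -> exists d px py qx qy,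
        [/\ d != 0, px * qy - py * qx != 0 &
            forall t, phi t = (p.1, proj (cexp (d * t) * px + qx) (cexp (d * t) * py + qy))]].
Proof.
case: p => z q Mp; pose a := A z; pose b := B z; pose c := C z.
pose x0 := repX q; pose y0 := repY q; pose k := b ^+ 2 / 4 - a * c.
have Q0 : a * x0 ^+ 2 + b * x0 * y0 + c * y0 ^+ 2 != 0.
  apply/eqP => Q0; apply: Mp; rewrite -(proj_rep q).
  by apply/(@quadric_proj R A B C z a b c erefl erefl erefl _ _ (rep_neq0 q)).
have [d [ch [sh [dk dch dsh [ch0 sh0] [det1 Ed]]]]] := exp_pair k.
have mx := @orb_maximal R A B C z x0 y0 a b c k erefl erefl erefl erefl Q0 ch sh dch dsh ch0 sh0 det1.
have un := @maximal_orb R A B C z x0 y0 a b c k erefl erefl erefl erefl Q0 ch sh dch dsh ch0 sh0 det1.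
have tr := @trajectory_orb R A B C z x0 y0 a b c k erefl erefl erefl erefl Q0 ch sh dch dsh ch0 sh0 det1.
have nz := @orb_neq0 R x0 y0 a b c k erefl Q0 ch sh det1.
rewrite proj_rep in mx un tr.
exists (orb z x0 y0 a b c ch sh); split=> // dz.
have d0 : d != 0.
  apply: contraNneq dz => d0; move: dk; rewrite d0 expr0n /= => /esym k0.
  have -> : disc A B C z = 4 * k by rewrite /disc -/a -/b -/c /k; field.
  by rewrite k0 mulr0.
pose nx := b / 2 * x0 + c * y0; pose ny := - a * x0 - b / 2 * y0.
(* P = (v + N v / d) / 2 and Q = (v - N v / d) / 2 are the components of v in the eigenspaces of d
   and -d. Multiplying exp(t N) v = e^(d t) P + e^(-d t) Q by e^(d t) does not move the projective
   point and produces the rate 2 d. P and Q are independent because det(P, Q) is the form at v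
   divided by 2 d. *)
exists (2 * d), ((x0 + nx / d) / 2), ((y0 + ny / d) / 2), ((x0 - nx / d) / 2), ((y0 - ny / d) / 2).
split.
- by rewrite mulf_neq0 // pnatr_eq0.
- have -> : (x0 + nx / d) / 2 * ((y0 - ny / d) / 2) - (y0 + ny / d) / 2 * ((x0 - nx / d) / 2) =
    (a * x0 ^+ 2 + b * x0 * y0 + c * y0 ^+ 2) / (2 * d) by rewrite /nx /ny; field.
  by rewrite mulf_neq0 // invr_eq0 mulf_neq0 // pnatr_eq0.
move=> t; rewrite /orb /=; congr pair.
have [chE shE] := Ed d0 t; set e := cexp (d * t) in chE shE.
have e0 : e != 0 by exact: cexp_neq0.
have eV : cexp (- (d * t)) = e^-1 by rewrite cexpN.
have e2 : cexp (2 * d * t) = e * e by rewrite -cexpD; congr cexp; ring.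
have EX : cexp (2 * d * t) * ((x0 + nx / d) / 2) + (x0 - nx / d) / 2 = e * orbX x0 y0 b c ch sh t.
  by rewrite /orbX chE shE eV e2 -/nx; field; rewrite d0 e0.
have EY : cexp (2 * d * t) * ((y0 + ny / d) / 2) + (y0 - ny / d) / 2 = e * orbY x0 y0 a b ch sh t.
  by rewrite /orbY chE shE eV e2 -/ny; field; rewrite d0 e0.
rewrite EX EY; apply: proj_eq; [by ring|exact: nz|].
by rewrite !mulf_eq0 (negbTE e0); exact: nz.
Qed.

Lemma riccati_complete : complete M X.
Proof. by move=> p /orbit_data[phi [mx _ _ _ _]]; exists phi. Qed.

Lemma riccati_vertical : vertical_trajectories M X.
Proof.
move=> p /orbit_data[phi [_ _ tr fib _]]; exists p.1; rewrite tr => q [t _ <-].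
exact: fib.
Qed.

(** Time enters only through s = exp(d t): [h] parametrizes the orbit by s and [g] recovers s, so
    that [g] along the flow is an exponential, hence holomorphic. *)
Lemma riccati_Cstar_orbit (p : CP1 R) : M p -> disc A B C p.1 != 0 ->
  trajectory_isomorphic M X p (@Cstar R).
Proof.
move=> Mp dp; have [phi [mx un tr _ /(_ dp)]] := orbit_data Mp.
move=> [d [px [py [qx [qy [d0 D0 phiE]]]]]].
pose h s := (p.1, proj (s * px + qx) (s * py + qy)) : CP1 R.
pose g (q : CP1 R) := pencil px py qx qy q.2.
have gh s : s != 0 -> g (h s) = s by move=> /(pencilE D0)[].
have phih t : phi t = h (cexp (d * t)) by exact: phiE.
exists h, g; split.
- move=> s s0; have [n0 _] := pencilE D0 s0.
  have dl u v : is_derive s 1 (fun s => s * u + v) u.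
    have := is_deriveDC (is_deriveZC u (is_derive_id s 1)) (is_derive_cst v s 1).
    have -> : (fun s => s * u + v) = (fun s => u * id s + cst v s).
      by apply/funext => y; rewrite mulrC.
    by rewrite mulr1 addr0.
  have [i [x [near_x xE]]] := proj_chart p.1 (dl px qx) (dl py qy) n0.
  exists i, x; split; first exact: near_x.
  case: i xE {near_x} => -[-> f0].
    have dq := @is_derive_quotC R (fun s => s * py + qy) (fun s => s * px + qx)
      s _ _ f0 (dl py qy) (dl px qx).
    by have [] := is_derive_pairC (is_derive_cst p.1 s 1) dq.
  have dq := @is_derive_quotC R (fun s => s * px + qx) (fun s => s * py + qy)
    s _ _ f0 (dl px qx) (dl py qy).
  by have [] := is_derive_pairC (is_derive_cst p.1 s 1) dq.
- move=> U psi /un[_ ->] t _.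
  have -> : g \o phi = (fun t => cexp (d * t)).
    by apply/funext => s; rewrite /comp phih gh // cexp_neq0.
  by have [] := is_derive_compC (is_deriveZC d (is_derive_id t 1)) (is_derive_cexp _).
- move=> s s0; split; last exact: gh.
  rewrite tr; have [t tE] := cexp_surj s0; exists (t / d) => //.
  by rewrite phih mulrCA divff // mulr1 tE.
move=> q; rewrite tr => -[t _ <-]; rewrite phih gh ?cexp_neq0 //; split=> //.
exact: cexp_neq0.
Qed.

Hypotheses (eA : entire A) (eB : entire B) (eC : entire C).
Hypothesis disc0 : exists z, disc A B C z != 0.

Lemma riccati_type_Cstar : of_type (@Cstar R) M X.
Proof.
exists (degenerate A B C); split.
- exact: degenerate_pluripolar.
(* Invariance holds because the exceptional set is a union of fibres cut with [M], and the flow is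
   vertical. *)
- move=> p [Mp dp] q; have [phi [[[_ _ _ sol _] _] _ tr fib _]] := orbit_data Mp.
  rewrite tr => -[t _ <-]; split; first by have [] := sol t I.
  by rewrite fib.
move=> p Mp np; apply: riccati_Cstar_orbit => //; apply/eqP => dp; exact: np.
Qed.

Lemma riccati_holomorphic : holomorphic_vfield [set: CP1 R] X.
Proof.
split=> [z w w0 _|i x _].
  rewrite /X /riccati /qform /=; congr pair.
  by field.
have d0 : differentiable (fun=> 0 : R[i]) x by exact: differentiable_cst.
case: i.
  exact: (differentiable_pair d0 (differentiableN (qform_differentiable eA eB eC true x))).
exact: (differentiable_pair d0 (qform_differentiable eA eB eC false x)).
Qed.

Lemma riccati_vanishes p : vanishes X p <-> quadric A B C p.
Proof.
split=> [[i [x [<- Xx]]]|].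
  apply/quadric_chart; move: Xx; rewrite /X /riccati; case: i => -[] //.
  by move=> /eqP; rewrite oppr_eq0 => /eqP.
have [i [x <-]] := chart_surj p => /quadric_chart q0.
by exists i, x; split=> //; rewrite /X /riccati; case: i q0 => ->; rewrite ?oppr0.
Qed.

End RiccatiField.

(** * The family W^u *)

Unset Implicit Arguments.

Theorem proposition2 (R : realType) (D : set (CP1 R)) (hD : double_section D) :
  exists W : {u : R[i] -> R[i] | entire u} -> vfield R,
    forall u : {u : R[i] -> R[i] | entire u},
      [/\ holomorphic_vfield (~` D) (W u),
          complete (~` D) (W u),
          of_type (@Cstar R) (~` D) (W u)
        & vertical_trajectories (~` D) (W u)] /\
      holomorphic_vfield [set: CP1 R] (W u) /\
      (forall p : CP1 R, vanishes (W u) p <-> D p).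
Proof.
have [a [b [c [ea eb ec [z0 dz0] DE]]]] := hD.
pose E (u f : R[i] -> R[i]) z := cexp (u z) * f z.
exists (fun u => riccati (E (sval u) a) (E (sval u) b) (E (sval u) c)) => -[u eu] /=.
have eE f : entire f -> entire (E u f).
  move=> ef z; have De := is_derive_compC (entireP eu z) (is_derive_cexp (u z)).
  by have [] := is_deriveMC De (entireP ef z).
have DE' : D = quadric (E u a) (E u b) (E u c).
  rewrite DE; apply/funext => -[z q]; apply/propext; rewrite /quadric /= /E.
  have e0 := cexp_neq0 (u z); case: q => [w|].
    have -> : cexp (u z) * a z * w ^+ 2 + cexp (u z) * b z * w + cexp (u z) * c z =
      cexp (u z) * (a z * w ^+ 2 + b z * w + c z) by ring.
    split=> [->|/eqP]; first by rewrite mulr0.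
    by rewrite mulf_eq0 (negbTE e0) => /eqP.
  split=> [->|/eqP]; first by rewrite mulr0.
  by rewrite mulf_eq0 (negbTE e0) => /eqP.
have disc0 : exists z, disc (E u a) (E u b) (E u c) z != 0.
  exists z0; have -> : disc (E u a) (E u b) (E u c) z0 =
    cexp (u z0) ^+ 2 * (b z0 ^+ 2 - 4%:R * a z0 * c z0) by rewrite /disc /E; ring.
  by rewrite mulf_neq0 // expf_neq0 // cexp_neq0.
have hol := riccati_holomorphic (eE _ ea) (eE _ eb) (eE _ ec).
rewrite DE'; split; last by split=> // p; exact: riccati_vanishes.
split.
- by case: hol => H1 H2; split=> [z w w0 _|i x _]; [exact: H1|exact: H2].
- exact: riccati_complete.
- exact: riccati_type_Cstar (eE _ ea) (eE _ eb) (eE _ ec) disc0.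
- exact: riccati_vertical.
Qed.
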